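(* Let $(\mathcal X,\|\cdot\|)$ be any separable Banach space, $f=(f_j)_{j\ge0}\in\mathcal M(\mathcal X)$, let $\lambda>0$ be such that $\mathbf E e^{\lambda\|d_j\|}<\infty$ for $j=1,2,\ldots$, let $D>0$, and let $\Psi:\mathcal X\to[0,\infty)$ be a $(2,D)$-smooth function. Put $D_*=\max(1,D)$ and $$e_j=D_*^2\,\mathbf E_{j-1}\left(e^{\lambda\|d_j\|}-1-\lambda\|d_j\|\right),\qquad j=1,2,\ldots.$$ Then for all $r\ge0$, $$\mathbf{Pr}\left(\sup_j\Psi(f_j)\ge r\right)\le 2e^{-\lambda r}\left\|\prod_{j=1}^\infty(1+e_j)\right\|_\infty\le 2\exp\left\{-\lambda r+\left\|\sum_{j=1}^\infty e_j\right\|_\infty\right\}.$$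
   Context: A function $\Psi:\mathcal X\to[0,\infty)$ on a Banach space $(\mathcal X,\|\cdot\|)$ is called $(2,D)$-smooth if $\Psi(0)=0$, and for all $x,v\in\mathcal X$: $|\Psi(x+v)-\Psi(x)|\le\|v\|$ and $\Psi^2(x+v)-2\Psi^2(x)+\Psi^2(x-v)\le 2D^2\|v\|^2$. For a separable Banach space $\mathcal X$, $\mathcal M(\mathcal X)$ is the class of all martingales $f=(f_0,f_1,\ldots)$ of Bochner-integrable random vectors in $\mathcal X$ with $f_0\equiv 0$, defined on some probability space with respect to some filtration $(F_0,F_1,\ldots)$ (both may depend on $f$). Put $d_j=f_j-f_{j-1}$ for $j\ge1$; $\mathbf E_{j-1}$ is the conditional expectation given $F_{j-1}$; $\|\cdot\|_\infty$ of a real random variable is its essential supremum norm (possibly $+\infty$). *)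

(* Defs.v *)
From mathcomp Require Import all_boot all_order all_algebra.
From mathcomp Require Import all_classical all_reals all_analysis.
Set Implicit Arguments.
Unset Strict Implicit.
Unset Printing Implicit Defensive.
Import Order.TTheory GRing.Theory Num.Theory.
Import numFieldNormedType.Exports.
Local Open Scope classical_set_scope.
Local Open Scope ring_scope.

Definition separable (X : topologicalType) : Prop :=
  exists2 S : set X, countable S & dense S.

Definition smooth2 (R : realType) (X : normedModType R) (D : R) (Psi : X -> R)
    : Prop :=
  [/\ forall x, 0 <= Psi x,
      Psi 0 = 0,
      forall x v, `|Psi (x + v) - Psi x| <= `|v| &
      forall x v, Psi (x + v) ^+ 2 - 2 * Psi x ^+ 2 + Psi (x - v) ^+ 2
                  <= 2 * D ^+ 2 * `|v| ^+ 2].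

(* Here G is meant to be a sub-sigma-algebra, given as a set of subsets of T,
   so that measurability with respect to the members of a filtration can be
   expressed without changing the measurable structure of T. *)
Definition borel_measurable (T : Type) (G : set (set T))
    (X : topologicalType) (f : T -> X) : Prop :=
  forall B, <<s @open X >> B -> G (f @^-1` B).

Section bochner.
Context (R : realType) (dT : measure_display) (T : measurableType dT)
  (P : probability T R) (X : normedModType R).
Implicit Types (f g : T -> X) (s : nat -> T -> X) (A : set T).

Definition simple_vector (h : T -> X) : Prop :=
  finite_set (range h) /\ forall x, measurable (h @^-1` [set x]).

Definition simple_integral A (h : T -> X) : X :=
  \sum_(x \in range h) fine (P (A `&` h @^-1` [set x])) *: x.

Definition bochner_approx f s : Prop :=
  (forall n, simple_vector (s n)) /\
  ((\int[P]_w (`|f w - s n w|)%:E)%E @[n --> \oo] --> 0%E).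

(* On a separable space, Borel measurability is strong measurability. *)
Definition bochner_integrable f : Prop :=
  borel_measurable (@measurable dT T) f /\ exists s, bochner_approx f s.

Definition is_bochner_integral A f (I : X) : Prop :=
  exists2 s, bochner_approx f s & simple_integral A (s n) @[n --> \oo] --> I.

(* g is a version of E(f | G). *)
Definition bochner_cond_expectation (G : set (set T)) f g : Prop :=
  [/\ borel_measurable G g,
      bochner_integrable g &
      forall A, G A ->
        exists2 I, is_bochner_integral A f I & is_bochner_integral A g I].

Definition filtration (F : nat -> set (set T)) : Prop :=
  [/\ forall n, sigma_algebra setT (F n),
      forall n, F n `<=` @measurable dT T &
      forall n, F n `<=` F n.+1].

Definition martingale0 (F : nat -> set (set T)) (f : nat -> T -> X) : Prop :=
  [/\ filtration F,
      forall w, f 0%N w = 0,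
      forall n, borel_measurable (F n) (f n),
      forall n, bochner_integrable (f n) &
      forall n, bochner_cond_expectation (F n) (f n.+1) (f n)].

(* d_j = f_j - f_{j-1}, meaningful for j >= 1. *)
Definition mdiff (f : nat -> T -> X) (j : nat) (w : T) : X :=
  f j w - f j.-1 w.

End bochner.

(* g is a version of E(h | G), for an integrable real random variable h. *)
Definition cond_expectation (R : realType) (dT : measure_display)
    (T : measurableType dT) (P : probability T R) (G : set (set T))
    (h g : T -> R) : Prop :=
  [/\ borel_measurable G g,
      P.-integrable setT (EFin \o g) &
      forall A, G A -> (\int[P]_(w in A) (g w)%:E = \int[P]_(w in A) (h w)%:E)%E].

(* Main.v *)
Require Import Defs.
From mathcomp Require Import all_boot all_order all_algebra.
From mathcomp Require Import ring lra.
From mathcomp Require Import all_classical all_reals all_analysis.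
From mathcomp Require Import measurable_realfun ess_sup_inf.
Set Implicit Arguments.
Unset Strict Implicit.
Unset Printing Implicit Defensive.
Import Order.TTheory GRing.Theory Num.Theory.
Import numFieldNormedType.Exports.
Local Open Scope classical_set_scope.
Local Open Scope ring_scope.

(** Put [G x = cosh (lambda * Psi x)], [Ds = max 1 D] and
    [rem s = expR s - 1 - s].  Everything rests on the conditional estimate
    that the expectation of [G (f n.+1)] given [F n] is at most
    [(1 + e n.+1) * G (f n)].  It makes the quotient of [G (f n)] by the
    product of the [1 + e j], [j <= n], a nonnegative supermartingale that
    starts at 1.  Since [expR t / 2 <= cosh t], on the event that [Psi (f n)]
    exceeds [r'] for some [n] this quotient reaches the level
    [expR (lambda * r') / 2] divided by the essential supremum of the infinite
    product, so Ville's maximal inequality ([ville]) bounds the probability of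
    that event; then [r'] increases to [r] ([sup_tail]).  The second inequality
    of the theorem is [1 + x <= expR x].

    If [Psi] were smooth, the conditional expectation of [G (f n + t *: d)],
    where [d] is the next increment, would be a function of [t] whose derivative
    vanishes at 0, because [d] has conditional mean 0, and whose second
    derivative is at most [Ds ^+ 2 * G (f n)] times the conditional expectation
    of the second derivative of [rem (lambda * t * |d|)]; integrating twice
    gives the estimate.  Here [Psi] only satisfies an inequality on second
    differences.  That inequality passes to [G] ([cosh_second_diff]) and
    implies that the difference quotients from [t = 0] of
    [G (x + t *: v) - Ds ^+ 2 * G x * rem (lambda * |v| * t)] decrease in [t]
    ([slope_decreasing]).  Their supremum [superdiff x v] is a one-sided
    directional derivative of [G]; it is superlinear in [v]
    ([superlinear_superdiff]) and satisfies
    [G (x + v) <= G x + superdiff x v + Ds ^+ 2 * G x * rem (lambda * |v|)]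
    ([superdiff_upper]).

    The first-order term is removed by Jensen's inequality for superlinear
    Lipschitz functionals of a Bochner integral ([bochner_jensen]), at a fixed
    base point [x], so that no supporting functional has to be selected
    measurably.  To reach the random base point [f n], an event of [F n] is cut
    into countably many events on each of which [f n] stays close to one point,
    which separability permits; the resulting error is a factor that tends to 1
    with the size of the pieces ([one_step]).  The errors are kept
    multiplicative throughout because [G (f n)] need not be integrable. *)

(** * Hyperbolic functions *)

Section hyperbolic.
Context {R : realType}.
Implicit Types x y u p m b : R.

Definition cosh x : R := (expR x + expR (- x)) / 2.

Definition sinh x : R := (expR x - expR (- x)) / 2.

Lemma is_derive_expRN x : is_derive x 1 (fun y => expR (- y)) (- expR (- x)).
Proof.
have h : is_derive x 1 (expR \o -%R) (expR (- x) * -1).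
  by apply: is_derive1_comp.
by rewrite -mulrN1.
Qed.

Lemma is_derive_cosh x : is_derive x 1 cosh (sinh x).
Proof.
have -> : cosh = 2^-1 *: (expR + (fun y => expR (- y))).
  by apply/funext => y; rewrite /cosh mulrC.
have h := is_derive_expRN x.
by apply: is_derive_eq; rewrite /GRing.scale /= /sinh mulrC.
Qed.

Lemma is_derive_sinh x : is_derive x 1 sinh (cosh x).
Proof.
have -> : sinh = 2^-1 *: (expR - (fun y => expR (- y))).
  by apply/funext => y; rewrite /sinh mulrC.
have h := is_derive_expRN x.
by apply: is_derive_eq; rewrite /GRing.scale /= /cosh mulrC opprK.
Qed.

Lemma cosh_ge1 x : 1 <= cosh x.
Proof.
have := expR_ge1Dx x; have := expR_ge1Dx (- x); rewrite /cosh; lra.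
Qed.

Lemma cosh_gt0 x : 0 < cosh x.
Proof. exact: lt_le_trans (cosh_ge1 x). Qed.

Lemma cosh0 : cosh 0 = 1.
Proof. rewrite /cosh oppr0 expR0; lra. Qed.

Lemma sinh0 : sinh 0 = 0.
Proof. by rewrite /sinh oppr0 subrr mul0r. Qed.

Lemma coshN x : cosh (- x) = cosh x.
Proof. by rewrite /cosh opprK addrC. Qed.

Lemma sinhN x : sinh (- x) = - sinh x.
Proof. rewrite /sinh opprK; lra. Qed.

Lemma coshD x y : cosh (x + y) = cosh x * cosh y + sinh x * sinh y.
Proof. by rewrite /cosh /sinh opprD !expRD; field. Qed.

Lemma cosh_norm x : cosh `|x| = cosh x.
Proof. by case: (ger0P x) => // _; rewrite coshN. Qed.

Lemma ge0_of_derive (f df : R -> R) :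
    (forall x, is_derive x 1 f (df x)) -> f 0 = 0 ->
    (forall x, 0 <= x -> 0 <= df x) ->
  forall x, 0 <= x -> 0 <= f x.
Proof.
move=> fdf f0 df0 x; rewrite le_eqVlt => /predU1P[<-|x0]; first by rewrite f0.
have cf : {within `[0, x], continuous f}.
  apply: continuous_subspaceT => y.
  by apply: differentiable_continuous; apply/derivable1_diffP; case: (fdf y).
have [c] := @MVT R f df 0 x x0 (fun y _ => fdf y) cf.
rewrite in_itv/= f0 !subr0 => /andP[c0 _] ->.
by rewrite mulr_ge0 ?df0 // ltW.
Qed.

Lemma le_sinh x : 0 <= x -> x <= sinh x.
Proof.
move=> x0; rewrite -subr_ge0; move: x x0.
apply: (@ge0_of_derive (fun x => sinh x - x) (fun x => cosh x - 1)).
- by move=> x; have := is_derive_sinh x => h; exact: is_deriveB.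
- by rewrite sinh0 subrr.
- by move=> x _; rewrite subr_ge0 cosh_ge1.
Qed.

Lemma sinh_le x : 0 <= x -> sinh x <= x * cosh x.
Proof.
move=> x0; rewrite -subr_ge0; move: x x0.
apply: (@ge0_of_derive (fun x => x * cosh x - sinh x) (fun x => x * sinh x)).
- move=> x; have h1 := is_derive_sinh x; have h2 := is_derive_cosh x.
  apply: (@is_derive_eq _ _ _ (id * cosh - sinh)); rewrite /GRing.scale /=; lra.
- by rewrite sinh0 mul0r subrr.
- by move=> x x0; rewrite mulr_ge0 // (le_trans x0) // le_sinh.
Qed.

Lemma sinh_ge0 x : 0 <= x -> 0 <= sinh x.
Proof. by move=> x0; apply: le_trans (le_sinh x0). Qed.

Lemma cosh_sqr x : cosh x ^+ 2 = 1 + sinh x ^+ 2.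
Proof. by rewrite /cosh /sinh expRN; field; rewrite gt_eqF ?expR_gt0. Qed.

(** Halving the argument turns a first-order bound on [sinh] into a
    second-order bound on [cosh]. *)
Lemma cosh_half x : cosh x = 1 + 2 * sinh (x / 2) ^+ 2.
Proof.
rewrite [in LHS](_ : x = x / 2 + x / 2); last lra.
by rewrite coshD -!expr2 cosh_sqr; ring.
Qed.

Lemma cosh_lower x : 1 + x ^+ 2 / 2 <= cosh x.
Proof.
rewrite -(cosh_norm x) cosh_half -(real_normK (num_real x)).
have := @le_sinh (`|x| / 2); rewrite divr_ge0 // => /(_ isT) h.
have : (`|x| / 2) ^+ 2 <= sinh (`|x| / 2) ^+ 2.
  by rewrite ler_pXn2r // nnegrE ?divr_ge0 ?sinh_ge0 ?divr_ge0.
by move=> ?; nra.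
Qed.

Lemma cosh_upper x : cosh x <= 1 + x ^+ 2 / 2 * cosh x.
Proof.
rewrite -(cosh_norm x) -(real_normK (num_real x)).
have x0 := normr_ge0 x; set y := `|x| in x0 *.
have : sinh (y / 2) <= y / 2 * cosh (y / 2) by rewrite sinh_le // divr_ge0.
have y2 : 0 <= y / 2 by rewrite divr_ge0.
have := sinh_ge0 y2 => s0 h.
have : sinh (y / 2) ^+ 2 <= (y / 2 * cosh (y / 2)) ^+ 2.
  by rewrite ler_pXn2r // nnegrE ?mulr_ge0 // ltW // cosh_gt0.
have e : cosh (y / 2) ^+ 2 = (1 + cosh y) / 2.
  by rewrite [in RHS]cosh_half cosh_sqr; field.
move=> h2; rewrite [leRHS]exprMn e in h2; rewrite {1}cosh_half.
have := cosh_ge1 y => h3; have := sqr_ge0 y => h4; nra.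
Qed.

Lemma cosh_homo x y : `|x| <= `|y| -> cosh x <= cosh y.
Proof.
move=> xy; rewrite -(cosh_norm x) -(cosh_norm y).
rewrite [in leLHS]cosh_half [in leRHS]cosh_half lerD2l ler_pM2l //.
have h z : 0 <= z -> 0 <= sinh (z / 2) by move=> z0; rewrite sinh_ge0 // divr_ge0.
rewrite ler_pXn2r ?nnegrE ?h ?normr_ge0 //.
have h1 : `|x| / 2 <= `|y| / 2 by lra.
have e1 : expR (`|x| / 2) <= expR (`|y| / 2) by rewrite ler_expR.
have e2 : expR (- (`|y| / 2)) <= expR (- (`|x| / 2)) by rewrite ler_expR lerN2.
rewrite /sinh; lra.
Qed.

Lemma cosh_le_expR x y : cosh x <= expR `|x - y| * cosh y.
Proof.
have h1 : expR x <= expR `|x - y| * expR y.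
  by rewrite -expRD ler_expR -lerBlDr ler_norm.
have h2 : expR (- x) <= expR `|x - y| * expR (- y).
  by rewrite -expRD ler_expR -lerBlDr opprK addrC distrC ler_norm.
rewrite /cosh; lra.
Qed.

Lemma cosh_ge_expR x : expR x / 2 <= cosh x.
Proof. have := expR_ge0 (- x); rewrite /cosh; lra. Qed.

Lemma sinh_upper p b : `|p| <= b -> sinh p <= p + b ^+ 3 * cosh b.
Proof.
move=> pb; have b0 : 0 <= b by apply: le_trans pb.
have cb := cosh_gt0 b.
case: (lerP 0 p) => p0.
  have := sinh_le p0; have := cosh_upper p.
  have : cosh p <= cosh b by apply: cosh_homo; rewrite (ger0_norm b0).
  have : p ^+ 3 <= b ^+ 3 by rewrite lerXn2r ?nnegrE // -(ger0_norm p0).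
  have p3 : 0 <= p ^+ 3 by rewrite exprn_ge0.
  move=> h1 h2 h3 h4.
  have h5 : p * cosh p <= p + p ^+ 3 * cosh p.
    have : p * cosh p <= p * (1 + p ^+ 2 / 2 * cosh p) by rewrite ler_wpM2l.
    have := mulr_ge0 p3 (ltW (cosh_gt0 p)); lra.
  have h6 : p ^+ 3 * cosh p <= b ^+ 3 * cosh b.
    by apply: ler_pM => //; exact: ltW (cosh_gt0 _).
  lra.
have : - p <= sinh (- p) by rewrite le_sinh // oppr_ge0 ltW.
rewrite sinhN lerN2 => /le_trans; apply.
by rewrite lerDl mulr_ge0 ?exprn_ge0 // ltW.
Qed.

(** This is [G'' <= D ^+ 2 * a ^+ 2 * G] for [G = cosh U], [`|U'| <= a] and
    [(U ^+ 2)'' <= 2 * D ^+ 2 * a ^+ 2], stated with differences: [u] is the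
    value of [U] at a point, [p] and [m] are its values on both sides, [b] is
    the step times [a], and the factor [(1 + 2 * b) * cosh b] tends to 1.  After
    the addition formula, the linear part of the increments [dp] and [dm] is
    controlled through the bound on the squares, and [sinh u <= u * cosh u]
    balances what this costs against the quadratic part. *)
Lemma cosh_second_diff (D u p m b : R) : 1 <= D -> 0 <= u ->
    `|p - u| <= b -> `|m - u| <= b ->
    p ^+ 2 - 2 * u ^+ 2 + m ^+ 2 <= 2 * D ^+ 2 * b ^+ 2 ->
  cosh p + cosh m - 2 * cosh u
    <= D ^+ 2 * b ^+ 2 * ((1 + 2 * b) * cosh b) * cosh u.
Proof.
move=> D1; rewrite le_eqVlt => /predU1P[<-|u0] pb mb sq.
  have b0 : 0 <= b by apply: le_trans pb.
  rewrite subr0 in pb; rewrite subr0 in mb.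
  rewrite cosh0.
  have hb x : `|x| <= b -> cosh x <= cosh b.
    by move=> h; rewrite cosh_homo // (ger0_norm b0).
  have := hb _ pb; have := hb _ mb; have := cosh_upper b.
  have h1 : b ^+ 2 * cosh b <= D ^+ 2 * (b ^+ 2 * ((1 + 2 * b) * cosh b)).
    have B0 : 0 <= b ^+ 2 by rewrite sqr_ge0.
    have c0 := ltW (cosh_gt0 b).
    have B1 := mulr_ge0 B0 c0.
    have B2 : b ^+ 2 * cosh b <= b ^+ 2 * ((1 + 2 * b) * cosh b).
      by rewrite ler_wpM2l // ler_peMl //; lra.
    by rewrite (le_trans B2) // ler_peMl ?exprn_ege1 // (le_trans B1).
  lra.
set dp := p - u in pb *; set dm := m - u in mb *.
have ep : p = u + dp by rewrite /dp; lra.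
have em : m = u + dm by rewrite /dm; lra.
have b0 : 0 <= b by apply: le_trans pb.
clearbody dp dm; rewrite ep em !coshD; rewrite ep em in sq.
have su0 := sinh_ge0 (ltW u0).
have suc := sinh_le (ltW u0).
have cb := cosh_ge1 b; have cu := cosh_ge1 u.
have hC d : `|d| <= b -> cosh d <= 1 + d ^+ 2 / 2 * cosh b.
  move=> db; have := cosh_upper d.
  have : cosh d <= cosh b by rewrite cosh_homo // (ger0_norm b0).
  have := sqr_ge0 d; nra.
have := hC _ pb; have := hC _ mb; have := sinh_upper pb; have := sinh_upper mb.
set B := b ^+ 3 * cosh b => s1 s2 c1 c2.
set Q := (dp ^+ 2 + dm ^+ 2) / 2.
have Qb : Q <= b ^+ 2.
  have h d : `|d| <= b -> d ^+ 2 <= b ^+ 2.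
    by move=> db; rewrite -(real_normK (num_real d)) lerXn2r ?nnegrE.
  by rewrite /Q; have := h _ pb; have := h _ mb; lra.
have Q0 : 0 <= Q by rewrite /Q divr_ge0 // addr_ge0 // sqr_ge0.
(* the hypothesis on squares, solved for the sum of the increments *)
have lin : u * (dp + dm) <= D ^+ 2 * b ^+ 2 - Q by rewrite /Q; nra.
set S := sinh u / u.
have eS : sinh u = S * u by rewrite /S; field; rewrite gt_eqF.
have S0 : 0 <= S by rewrite divr_ge0 // ltW.
have SC : S <= cosh u by rewrite ler_pdivrMr // mulrC.
have t1 : cosh u * cosh dp + cosh u * cosh dm <= cosh u * (2 + Q * cosh b).
  by rewrite -mulrDr ler_wpM2l //; rewrite /Q; lra.
have t2 : sinh u * sinh dp + sinh u * sinh dm <= sinh u * (dp + dm + 2 * B).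
  by rewrite -mulrDr ler_wpM2l //; lra.
have t3 : sinh u * (dp + dm) <= S * (D ^+ 2 * b ^+ 2 - Q).
  by rewrite eS -mulrA ler_wpM2l.
(* the coefficient of [Q] is nonnegative, so [Q] may be replaced by its bound *)
have t4 : Q * (cosh u * cosh b - S) <= b ^+ 2 * (cosh u * cosh b - S).
  by rewrite ler_wpM2r // subr_ge0 (le_trans SC) // ler_peMr //; lra.
have D2 : 1 <= D ^+ 2 by rewrite exprn_ege1.
have b20 : 0 <= b ^+ 2 by rewrite sqr_ge0.
have t5 : (D ^+ 2 - 1) * (b ^+ 2) * S <= (D ^+ 2 - 1) * (b ^+ 2) * (cosh u * cosh b).
  by rewrite ler_wpM2l ?mulr_ge0 ?subr_ge0 // (le_trans SC) // ler_peMr //; lra.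
have suc' : sinh u <= cosh u.
  have := expR_ge0 (- u); rewrite /sinh /cosh; lra.
have t6 : sinh u * (2 * B) <= D ^+ 2 * (cosh u * (2 * B)).
  have B0 : 0 <= B by rewrite mulr_ge0 ?exprn_ge0 //; lra.
  have : sinh u * (2 * B) <= cosh u * (2 * B) by rewrite ler_wpM2r //; lra.
  move=> /le_trans; apply; rewrite ler_peMl //.
  by rewrite mulr_ge0 //; lra.
have -> : D ^+ 2 * b ^+ 2 * ((1 + 2 * b) * cosh b) * cosh u =
   D ^+ 2 * b ^+ 2 * (cosh u * cosh b) + D ^+ 2 * (cosh u * (2 * B)).
  by rewrite /B; ring.
lra.
Qed.

Definition expR_rem x : R := expR x - 1 - x.

Lemma expR_rem0 : expR_rem 0 = 0.
Proof. by rewrite /expR_rem expR0 subrr subrr. Qed.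

Lemma expR_rem_ge0 x : 0 <= expR_rem x.
Proof. have := expR_ge1Dx x; rewrite /expR_rem; lra. Qed.

Lemma expR_rem_le x : 0 <= x -> expR_rem x <= x ^+ 2 * expR x.
Proof.
move=> x0; have := expR_ge1Dx (- x); rewrite expRN => h.
have e0 := expR_gt0 x.
have h1 : expR x - 1 <= x * expR x.
  have : (1 - x) * expR x <= (expR x)^-1 * expR x by rewrite ler_wpM2r // ltW.
  by rewrite mulVf ?gt_eqF //; lra.
rewrite /expR_rem; have : x * (expR x - 1) <= x * (x * expR x) by rewrite ler_wpM2l.
lra.
Qed.

(** The second derivative of [expR_rem] is [expR]: the exponential growth of
    [cosh_of] along a ray is exactly what [expR_rem] compensates. *)
Lemma expR_rem_diff x b :
  expR x * b ^+ 2 <= expR_rem (x + b) + expR_rem (x - b) - 2 * expR_rem x.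
Proof.
have := cosh_lower b.
have : expR_rem (x + b) + expR_rem (x - b) - 2 * expR_rem x =
    expR x * (2 * (cosh b - 1)).
  by rewrite /expR_rem /cosh !expRD; field.
move=> -> h; rewrite ler_wpM2l ?expR_ge0 //; lra.
Qed.

End hyperbolic.

(** * Superdifferentials of the hyperbolic cosine of a smooth function *)

(** Such a functional is concave; this is the form in which Jensen's inequality
    for it reduces to finite sums.  The inequality on multiples implies equality
    for positive [a], by using it also with [a^-1]. *)
Definition superlinear (R : realType) (X : normedModType R) (q : X -> R) : Prop :=
  (forall v w, q v + q w <= q (v + w)) /\
  (forall (a : R) v, 0 <= a -> a * q v <= q (a *: v)).

Section superlinear_lipschitz.
Context (R : realType) (X : normedModType R) (q : X -> R) (L : R).
Hypotheses (sq : superlinear q) (Lq : forall v, - (L * `|v|) <= q v).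

Lemma superlinear_le v w : q v <= q w + L * `|v - w|.
Proof.
have := sq.1 v (w - v); rewrite subrKC.
by have := Lq (w - v); rewrite distrC; lra.
Qed.

Lemma superlinear_norm_le v : `|q v| <= L * `|v|.
Proof.
have := sq.1 0 0; rewrite addr0 => q0.
have := superlinear_le v 0; rewrite subr0 => h.
by rewrite ler_norml Lq /=; lra.
Qed.

End superlinear_lipschitz.

Section smooth.
Context (R : realType) (X : normedModType R) (Psi : X -> R) (D lam : R).
Hypotheses (D_ge1 : 1 <= D) (smoothPsi : smooth2 D Psi) (lam_gt0 : 0 < lam).
Implicit Types x y v w : X.

Definition cosh_of (x : X) : R := cosh (lam * Psi x).

Local Notation G := cosh_of.

Lemma cosh_of_gt0 x : 0 < G x.
Proof. exact: cosh_gt0. Qed.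

Lemma cosh_of_le x y : G y <= expR (lam * `|y - x|) * G x.
Proof.
apply: (le_trans (cosh_le_expR _ (lam * Psi x))).
rewrite ler_wpM2r ?(ltW (cosh_gt0 _)) // ler_expR -mulrBr normrM gtr0_norm //.
rewrite ler_pM2l //; case: smoothPsi => _ _ /(_ x (y - x)) + _.
by rewrite subrKC.
Qed.

Lemma cosh_of_second_diff x v b : b = lam * `|v| ->
  G (x + v) + G (x - v) - 2 * G x
    <= D ^+ 2 * b ^+ 2 * ((1 + 2 * b) * cosh b) * G x.
Proof.
move=> b_def; case: smoothPsi => P0 _ P1 P2.
have l0 := ltW lam_gt0.
have hb w : `|w| = `|v| -> `|lam * Psi (x + w) - lam * Psi x| <= b.
  by move=> wv; rewrite -mulrBr normrM gtr0_norm // b_def ler_pM2l // -wv P1.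
apply: cosh_second_diff => //; [by rewrite mulr_ge0|exact: hb| |].
  by apply: hb; rewrite normrN.
rewrite b_def !exprMn; have := P2 x v => h.
have : lam ^+ 2 * (Psi (x + v) ^+ 2 - 2 * Psi x ^+ 2 + Psi (x - v) ^+ 2)
   <= lam ^+ 2 * (2 * D ^+ 2 * `|v| ^+ 2) by rewrite ler_wpM2l // sqr_ge0.
lra.
Qed.

Lemma continuous_Psi : continuous Psi.
Proof.
move=> x; apply/cvgrPdist_le => e e0; near=> y.
case: smoothPsi => _ _ /(_ x (y - x)) + _; rewrite subrKC.
rewrite distrC => /le_trans; apply; rewrite distrC; near: y.
by apply: cvgr_dist_le e0; exact: cvg_id.
Unshelve. all: by end_near. Qed.

Lemma continuous_cosh : continuous (@cosh R).
Proof.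
move=> x; apply: differentiable_continuous; apply/derivable1_diffP.
by case: (is_derive_cosh x).
Qed.

Lemma continuous_cosh_of : continuous G.
Proof.
move=> x; apply: (@continuous_comp _ _ _ (fun y => lam * Psi y) cosh).
  2: exact: continuous_cosh.
by apply: cvgM; [exact: cvg_cst|exact: continuous_Psi].
Qed.

Lemma continuous_ray x v : continuous (fun s : R => G (x + s *: v)).
Proof.
move=> s; apply: (@continuous_comp R X R (fun s : R => x + s *: v) G).
  2: exact: continuous_cosh_of.
apply: cvgD; first exact: cvg_cst.
by apply: cvgZr_tmp; exact: cvg_id.
Qed.

Lemma continuous_expR_rem : continuous (@expR_rem R).
Proof.
move=> x; rewrite /expR_rem; apply: cvgB; last exact: cvg_id.
by apply: cvgB; [exact: continuous_expR|exact: cvg_cst].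
Qed.

(** If the chord inequality failed, the deviation [psi] from the chord over
    [0, t] would have a negative minimum at an interior point [c], where its
    second differences are nonnegative.  But at [c], with [b] the step times
    [lam * |v|], the second difference of [G] along [v] is at most
    [D ^+ 2 * b ^+ 2 * G (x + c *: v)] up to a factor tending to 1, that of the
    compensating term is at least [E * b ^+ 2 * expR (lam * |v| * c) * G x], and
    [G (x + c *: v) <= expR (lam * |v| * c) * G x].  The gap between [E] and
    [D ^+ 2] absorbs the factor. *)
Lemma slope_decreasing_gt (E : R) x v (h t : R) :
    D ^+ 2 < E -> 0 < h -> h <= t ->
  h * (G (x + t *: v) - G x - E * G x * expR_rem (lam * `|v| * t))
    <= t * (G (x + h *: v) - G x - E * G x * expR_rem (lam * `|v| * h)).
Proof.
move=> DE h0 ht.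
have t0 : 0 < t by apply: lt_le_trans ht.
have [->|v0] := eqVneq v 0.
  by rewrite !scaler0 addr0 subrr normr0 mulr0 !mul0r expR_rem0 mulr0 subr0 !mulr0.
set a := lam * `|v|; have a0 : 0 < a by rewrite mulr_gt0 // normr_gt0.
set phi := fun s => G (x + s *: v) - G x - E * G x * expR_rem (a * s).
rewrite -/(phi t) -/(phi h).
set psi := fun s => t * phi s - s * phi t.
rewrite -subr_ge0 -/(psi h).
have cpsi : {within `[0, t], continuous psi}.
  apply: continuous_subspaceT => s; apply: cvgB; last first.
    by apply: cvgM; [exact: cvg_id|exact: cvg_cst].
  apply: cvgM; first exact: cvg_cst.
  apply: cvgB; last first.
    apply: cvgM; first exact: cvg_cst.
    apply: (@continuous_comp _ _ _ (fun s => a * s) expR_rem).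
      2: exact: continuous_expR_rem.
    by apply: cvgM; [exact: cvg_cst|exact: cvg_id].
  apply: cvgB; last exact: cvg_cst.
  exact: continuous_ray.
have [c] := EVT_min (ltW t0) cpsi.
rewrite in_itv /= => /andP[c0 ct] minc.
have psi0 : psi 0 = 0.
  by rewrite /psi /phi scale0r addr0 subrr mulr0 expR_rem0 mulr0 subr0 mulr0 mul0r subr0.
have psit : psi t = 0 by rewrite /psi subrr.
have mh : psi c <= psi h by apply: minc; rewrite in_itv /= (ltW h0).
rewrite leNgt; apply/negP => psih0.
have c0' : 0 < c.
  rewrite lt_neqAle c0 andbT; apply/eqP => e; rewrite -e psi0 in mh; lra.
have ct' : c < t.
  rewrite lt_neqAle ct andbT; apply/eqP => e; rewrite e psit in mh; lra.
(* near an interior minimum all second differences are nonnegative *)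
have D20 : 0 < D ^+ 2 by rewrite exprn_gt0 // (lt_le_trans _ D_ge1).
(* a step [d] with [a * d <= be] suffices: [(1 + 2 * b) * cosh b] is at most
   [expR (3 * b)], which must stay below [E / D ^+ 2] *)
set be := ln (E / D ^+ 2) / 4.
have E0 : 0 < E by apply: lt_trans DE.
have be0 : 0 < be by rewrite divr_gt0 // ln_gt0 // ltr_pdivlMr // mul1r.
set d := Num.min (Num.min c (t - c)) (be / a).
have d0 : 0 < d by rewrite /d !lt_min c0' subr_gt0 ct' divr_gt0.
have dc : d <= c by rewrite /d ge_min ge_min lexx.
have dt : d <= t - c by rewrite /d ge_min ge_min lexx orbT.
have db : a * d <= be.
  have : d <= be / a by rewrite /d ge_min lexx orbT.
  by rewrite ler_pdivlMr // mulrC.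
set b := a * d in db.
have b0 : 0 < b by rewrite mulr_gt0.
have m1 : psi c <= psi (c + d) by apply: minc; rewrite in_itv /=; apply/andP; split; lra.
have m2 : psi c <= psi (c - d) by apply: minc; rewrite in_itv /=; apply/andP; split; lra.
have bE : D ^+ 2 * ((1 + 2 * b) * cosh b) < E.
  have h1 : (1 + 2 * b) * cosh b <= expR (2 * b) * expR b.
    apply: ler_pM; [lra|exact: ltW (cosh_gt0 _)|exact: expR_ge1Dx|].
    rewrite /cosh; have : expR (- b) <= expR b by rewrite ler_expR; lra.
    lra.
  rewrite -expRD in h1.
  have h2 : expR (2 * b + b) < E / D ^+ 2.
    rewrite -[ltRHS]lnK ?posrE ?divr_gt0 // ltr_expR.
    by rewrite /be in be0 db; lra.
  by rewrite mulrC -ltr_pdivlMr //; apply: le_lt_trans h2.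
have eb : b = lam * `|d *: v| by rewrite normrZ (gtr0_norm d0) /b /a; ring.
have sd := cosh_of_second_diff (x + c *: v) eb.
rewrite -!addrA -scalerDl -scalerBl in sd.
have rd := expR_rem_diff (a * c) b.
rewrite /b -mulrDr -mulrBr -/b in rd.
have gc : G (x + c *: v) <= expR (a * c) * G x.
  apply: (le_trans (cosh_of_le x _)).
  rewrite addrAC subrr add0r normrZ gtr0_norm //.
  by rewrite /a -mulrA [_ * c]mulrC.
have G0 := cosh_of_gt0 x.
have : 0 <= t * (phi (c + d) + phi (c - d) - 2 * phi c).
  have -> : t * (phi (c + d) + phi (c - d) - 2 * phi c) =
    psi (c + d) + psi (c - d) - 2 * psi c by rewrite /psi; ring.
  lra.
rewrite pmulr_rge0 // => hp.
have l1 : E * G x * (expR (a * c) * b ^+ 2) <= E * G x *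
    (expR_rem (a * (c + d)) + expR_rem (a * (c - d)) - 2 * expR_rem (a * c)).
  by rewrite ler_wpM2l // mulr_ge0 // ltW.
have b2 : 0 < b ^+ 2 by rewrite exprn_gt0.
have l2 : D ^+ 2 * b ^+ 2 * ((1 + 2 * b) * cosh b) * G (x + c *: v) <=
    D ^+ 2 * b ^+ 2 * ((1 + 2 * b) * cosh b) * (expR (a * c) * G x).
  rewrite ler_wpM2l //; apply: mulr_ge0; first by rewrite mulr_ge0 // ltW.
  by rewrite mulr_ge0 ?(ltW (cosh_gt0 _)) //; lra.
have l3 : D ^+ 2 * ((1 + 2 * b) * cosh b) * (b ^+ 2 * (expR (a * c) * G x))
    < E * (b ^+ 2 * (expR (a * c) * G x)).
  by rewrite ltr_pM2r // mulr_gt0 // mulr_gt0 // expR_gt0.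
rewrite /phi in hp; lra.
Qed.

Lemma slope_decreasing x v (h t : R) : 0 < h -> h <= t ->
  h * (G (x + t *: v) - G x - D ^+ 2 * G x * expR_rem (lam * `|v| * t))
    <= t * (G (x + h *: v) - G x - D ^+ 2 * G x * expR_rem (lam * `|v| * h)).
Proof.
move=> h0 ht; apply/ler_addgt0Pr => e e0.
set K := `|h * (G x * expR_rem (lam * `|v| * t))| + 1.
have K0 : 0 < K by rewrite ltr_pwDr.
have eK : 0 < e / K by rewrite divr_gt0.
have := @slope_decreasing_gt (D ^+ 2 + e / K) x v h t.
rewrite ltrDl => /(_ eK h0 ht).
have h1 : e / K * (h * (G x * expR_rem (lam * `|v| * t))) <= e.
  rewrite mulrAC ler_pdivrMr // ler_pM2l //.
  by rewrite /K (le_trans (ler_norm _)) // lerDl.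
have h2 : 0 <= e / K * (t * (G x * expR_rem (lam * `|v| * h))).
  apply: mulr_ge0; first exact: ltW.
  apply: mulr_ge0; first lra.
  by rewrite mulr_ge0 ?expR_rem_ge0 // ltW // cosh_of_gt0.
lra.
Qed.

(** The difference quotient of [G] along [v], compensated so that it decreases
    in [t] ([le_slope]). *)
Definition slope x v (t : R) : R :=
  (G (x + t *: v) - G x - D ^+ 2 * G x * expR_rem (lam * `|v| * t)) / t.

(** The one-sided directional derivative of [G] at [x]: the limit of the slopes
    at 0, which by monotonicity is their supremum. *)
Definition superdiff x v : R := sup [set slope x v t | t in [set t | 0 < t]].

Lemma le_slope x v (h t : R) : 0 < h -> h <= t -> slope x v t <= slope x v h.
Proof.
move=> h0 ht; have t0 : 0 < t by apply: lt_le_trans ht.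
rewrite /slope ler_pdivrMr // [leRHS]mulrAC ler_pdivlMr //.
by rewrite mulrC [leRHS]mulrC slope_decreasing.
Qed.

Lemma slope_upper x v (t : R) : 0 < t -> slope x v t <= lam * `|v| * G x.
Proof.
move=> t0; rewrite ler_pdivrMr //.
set a := lam * `|v| * t.
have h : G (x + t *: v) <= expR a * G x.
  have := cosh_of_le x (x + t *: v).
  rewrite addrAC subrr add0r normrZ (gtr0_norm t0).
  by have -> : lam * (t * `|v|) = a by rewrite /a; ring.
have G0 := cosh_of_gt0 x.
have D2 : 1 <= D ^+ 2 by rewrite exprn_ege1.
have h1 : 1 * (G x * expR_rem a) <= D ^+ 2 * (G x * expR_rem a).
  by rewrite ler_wpM2r // mulr_ge0 ?expR_rem_ge0 // ltW.
have e : lam * `|v| * G x * t = a * G x by rewrite /a; ring.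
by rewrite e; move: h1; rewrite /expR_rem; lra.
Qed.

Lemma has_sup_slope x v : has_sup [set slope x v t | t in [set t | 0 < t]].
Proof.
split; first by exists (slope x v 1); exists 1 => //=; exact: ltr01.
by exists (lam * `|v| * G x) => _ [t /= t0 <-]; exact: slope_upper.
Qed.

Lemma slope_le_superdiff x v (t : R) : 0 < t -> slope x v t <= superdiff x v.
Proof.
by move=> t0; apply: ub_le_sup; [exact: (has_sup_slope x v).2|exists t].
Qed.

Lemma superdiff_le x v (y : R) :
  (forall t, 0 < t -> slope x v t <= y) -> superdiff x v <= y.
Proof.
move=> h; apply: ge_sup; first exact: (has_sup_slope x v).1.
by move=> _ [t /= t0 <-]; exact: h.
Qed.

Lemma slope0 x t : slope x 0 t = 0.
Proof.
by rewrite /slope scaler0 addr0 normr0 mulr0 mul0r expR_rem0 mulr0 subrr subr0 mul0r.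
Qed.

(** The points [x + 2t v] and [x + 2t w] are symmetric about [x + t (v + w)], so
    the second difference of [G] there, which is quadratic in [t], compares the
    three slopes. *)
Lemma slopeD x v w : exists C, forall t : R, 0 < t -> t <= 1 ->
  slope x v (2 * t) + slope x w (2 * t) <= slope x (v + w) t + C * t.
Proof.
set m := lam * `|v - w|; set M := lam * `|v + w|.
have m0 : 0 <= m by rewrite mulr_ge0 // ltW.
have M0 : 0 <= M by rewrite mulr_ge0 // ltW.
have G0 := cosh_of_gt0 x.
have D20 : 0 <= D ^+ 2 by rewrite sqr_ge0.
set C1 := D ^+ 2 * m ^+ 2 * ((1 + 2 * m) * cosh m) * (expR M * G x).
set C2 := D ^+ 2 * G x * (M ^+ 2 * expR M).
exists (C1 / 2 + C2) => t t0 t1.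
set y := x + t *: (v + w).
have etm : t * m = lam * `|t *: (v - w)|.
  by rewrite normrZ (gtr0_norm t0) /m; ring.
have sd := cosh_of_second_diff y etm.
have e1 : y + t *: (v - w) = x + (2 * t) *: v.
  rewrite /y -addrA -scalerDr addrACA subrr addr0 -mulr2n.
  by rewrite -scaler_nat scalerA mulrC.
have e2 : y - t *: (v - w) = x + (2 * t) *: w.
  rewrite /y -addrA -scalerBr opprB [v + w]addrC addrACA subrr addr0 -mulr2n.
  by rewrite -scaler_nat scalerA mulrC.
rewrite e1 e2 in sd.
have tm0 : 0 <= t * m by rewrite mulr_ge0 // ltW.
have tm1 : t * m <= m by rewrite ler_piMl.
have t20 : 0 <= t ^+ 2 by rewrite sqr_ge0.
have cm := cosh_gt0 m; have ctm := cosh_gt0 (t * m).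
have h1 : (1 + 2 * (t * m)) * cosh (t * m) <= (1 + 2 * m) * cosh m.
  apply: ler_pM; [lra|exact: ltW|lra|].
  by apply: cosh_homo; rewrite !ger0_norm.
have h2 : G y <= expR M * G x.
  apply: (le_trans (cosh_of_le x y)); rewrite ler_wpM2r ?(ltW G0) // ler_expR.
  rewrite /y addrAC subrr add0r normrZ (gtr0_norm t0) mulrCA -/M.
  by rewrite ler_piMl.
have h3 : G (x + (2 * t) *: v) + G (x + (2 * t) *: w) - 2 * G y <= t ^+ 2 * C1.
  apply: (le_trans sd); rewrite /C1.
  have -> : D ^+ 2 * (t * m) ^+ 2 * ((1 + 2 * (t * m)) * cosh (t * m)) * G y =
    (t ^+ 2 * (D ^+ 2 * m ^+ 2)) * (((1 + 2 * (t * m)) * cosh (t * m)) * G y).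
    by ring.
  have -> : t ^+ 2 * (D ^+ 2 * m ^+ 2 * ((1 + 2 * m) * cosh m) * (expR M * G x)) =
    (t ^+ 2 * (D ^+ 2 * m ^+ 2)) * (((1 + 2 * m) * cosh m) * (expR M * G x)).
    by ring.
  rewrite ler_wpM2l //.
    by apply: mulr_ge0 => //; apply: mulr_ge0 => //; exact: sqr_ge0.
  apply: ler_pM => //; [|exact: ltW (cosh_of_gt0 y)].
  by rewrite mulr_ge0 ?(ltW ctm) //; lra.
have h4 : D ^+ 2 * G x * expR_rem (M * t) <= t ^+ 2 * C2.
  have -> : t ^+ 2 * C2 = D ^+ 2 * G x * ((M * t) ^+ 2 * expR M).
    by rewrite /C2; ring.
  rewrite ler_wpM2l //; first by rewrite mulr_ge0 // ltW.
  have Mt0 : 0 <= M * t by rewrite mulr_ge0 // ltW.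
  apply: (le_trans (expR_rem_le Mt0)); rewrite ler_wpM2l ?sqr_ge0 // ler_expR.
  by rewrite ler_piMr.
have h5 z : 0 <= D ^+ 2 * G x * expR_rem z.
  by rewrite mulr_ge0 ?expR_rem_ge0 // mulr_ge0 // ltW.
rewrite /slope -/M -/y -mulrDl.
have t2 : 0 < 2 * t by lra.
rewrite ler_pdivrMr // [leRHS]mulrDl.
have -> : (G y - G x - D ^+ 2 * G x * expR_rem (M * t)) / t * (2 * t) =
   2 * (G y - G x - D ^+ 2 * G x * expR_rem (M * t)) by field; rewrite gt_eqF.
have := h5 (lam * `|v| * (2 * t)); have := h5 (lam * `|w| * (2 * t)).
lra.
Qed.

Lemma superdiffD x v w : superdiff x v + superdiff x w <= superdiff x (v + w).
Proof.
have [C hC] := slopeD x v w.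
rewrite -lerBrDr; apply: superdiff_le => t0 t0_gt0.
rewrite lerBrDr addrC -lerBrDr; apply: superdiff_le => t1 t1_gt0.
rewrite lerBrDr addrC; apply/ler_addgt0Pr => e e0.
set K := `|C| + 1; have K0 : 0 < K by rewrite ltr_pwDr.
set t := Num.min (Num.min (t0 / 2) (t1 / 2)) (Num.min 1 (e / K)).
have tgt0 : 0 < t by rewrite /t !lt_min !divr_gt0 // ltr01.
have tt0 : 2 * t <= t0.
  by have : t <= t0 / 2; [rewrite /t !ge_min lexx|lra].
have tt1 : 2 * t <= t1.
  by have : t <= t1 / 2; [rewrite /t !ge_min lexx orbT|lra].
have tle1 : t <= 1 by rewrite /t !ge_min lexx !orbT.
have tK : C * t <= e.
  have : t <= e / K by rewrite /t !ge_min lexx !orbT.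
  rewrite ler_pdivlMr // => /(le_trans _); apply.
  by rewrite mulrC ler_pM2l // /K (le_trans (ler_norm _)) // lerDl.
have t2 : 0 < 2 * t by lra.
have := hC _ tgt0 tle1.
have := le_slope x v t2 tt0; have := le_slope x w t2 tt1.
have := slope_le_superdiff x (v + w) tgt0.
lra.
Qed.

Lemma superlinear_superdiff x : superlinear (superdiff x).
Proof.
split=> [v w|a v]; first exact: superdiffD.
rewrite le_eqVlt => /predU1P[<-|a0].
  by rewrite mul0r scale0r -(slope0 x 1) slope_le_superdiff.
rewrite mulrC -ler_pdivlMr //; apply: superdiff_le => t t0.
have ta : 0 < t / a by rewrite divr_gt0.
rewrite ler_pdivlMr //; apply: le_trans (slope_le_superdiff x _ ta).
rewrite /slope scalerA divfK ?gt_eqF // normrZ gtr0_norm //.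
have -> : lam * (a * `|v|) * (t / a) = lam * `|v| * t by field; rewrite gt_eqF.
by rewrite invf_div [leRHS]mulrA [leRHS]mulrAC.
Qed.

Definition superdiff_lip : R := lam * (1 + D ^+ 2 * expR 1).

Lemma superdiff_lip_ge0 : 0 <= superdiff_lip.
Proof.
apply: mulr_ge0; first exact: ltW.
by rewrite addr_ge0 // mulr_ge0 ?sqr_ge0 ?expR_ge0.
Qed.

(** The slope at [t = (lam * `|v|)^-1], where the compensation is of the order of
    [G x], already gives the bound. *)
Lemma superdiff_lower x v : - (superdiff_lip * G x * `|v|) <= superdiff x v.
Proof.
have [->|v0] := eqVneq v 0.
  by rewrite normr0 mulr0 oppr0 -(slope0 x 1) slope_le_superdiff.
set a := lam * `|v|; have a0 : 0 < a by rewrite mulr_gt0 // normr_gt0.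
have ai : 0 < a^-1 by rewrite invr_gt0.
apply: le_trans (slope_le_superdiff x v ai).
rewrite /slope invrK -/a mulfV ?gt_eqF //.
have G0 := cosh_of_gt0 x; have G1 := cosh_of_gt0 (x + a^-1 *: v).
have r1 : expR_rem 1 <= expR 1 :> R by rewrite /expR_rem; lra.
have : D ^+ 2 * G x * expR_rem 1 <= D ^+ 2 * G x * expR 1.
  by rewrite ler_wpM2l // mulr_ge0 ?sqr_ge0 // ltW.
move=> h; rewrite /superdiff_lip.
have -> : - (lam * (1 + D ^+ 2 * expR 1) * G x * `|v|) =
  (- G x - D ^+ 2 * G x * expR 1) * a by rewrite /a; ring.
by rewrite ler_wpM2r ?(ltW a0) //; lra.
Qed.

(** The slope at [t = 1] is at most the supremum. *)
Lemma superdiff_upper x v :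
  G (x + v) <= G x + superdiff x v + D ^+ 2 * G x * expR_rem (lam * `|v|).
Proof.
have := slope_le_superdiff x v ltr01.
by rewrite /slope scale1r mulr1 divr1; lra.
Qed.

End smooth.

(** * Inequalities between integrals over the events of a sub-sigma-algebra *)

Section borel_measurable.

Lemma borel_measurable_comp (T : Type) (Fs : set (set T)) (X Y : topologicalType)
    (q : X -> Y) (f : T -> X) :
  continuous q -> borel_measurable Fs f -> borel_measurable Fs (q \o f).
Proof.
move=> cq mf B; move: B.
suff h : <<s @open Y >> `<=` [set B | <<s @open X >> (q @^-1` B)].
  by move=> B /h qB; exact: (mf _ qB).
apply: smallest_sub; last first.
  by move=> B oB; apply: sub_sigma_algebra; move/continuousP : cq; exact.
have [S0 SC SU] := @smallest_sigma_algebra X setT open.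
split => /=.
- by rewrite preimage_set0.
- by move=> B mB; exact: SC.
- by move=> B mB; rewrite preimage_bigcup; exact: SU.
Qed.

Lemma borel_measurableS (T : Type) (Fs Gs : set (set T)) (X : topologicalType)
    (f : T -> X) :
  Fs `<=` Gs -> borel_measurable Fs f -> borel_measurable Gs f.
Proof. by move=> FG mf B /mf; exact: FG. Qed.

Lemma measurable_borelE (R : realType) :
  @measurable _ (measurableTypeR R) = <<s @open R >>.
Proof.
rewrite (RGenOpens.measurableE R); apply/seteqP; split; apply: smallest_sub.
- exact: smallest_sigma_algebra.
- by move=> _ [a [b ->]]; apply: sub_sigma_algebra; exact: interval_open.
- rewrite -(RGenOpens.measurableE R); exact: sigma_algebra_measurable.
- by move=> B oB; rewrite -(RGenOpens.measurableE R); exact: open_measurable.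
Qed.

Lemma borel_measurable_fun (R : realType) (d : measure_display)
    (T : measurableType d) (g : T -> R) :
  borel_measurable (@measurable d T) g <-> measurable_fun [set: T] g.
Proof.
split=> [mg _ B mB|mg B mB].
  by rewrite setTI; apply: mg; rewrite -measurable_borelE.
by move: mB; rewrite -measurable_borelE => mB; rewrite -[X in measurable X]setTI; exact: mg.
Qed.

(** This gives access to the closure properties of [measurable_fun] for functions
    measurable with respect to a sub-sigma-algebra. *)
Lemma borel_measurable_sigma (R : realType) (T : pointedType)
    (Fs : set (set T)) (g : T -> R) : sigma_algebra setT Fs ->
  borel_measurable Fs g <->
  measurable_fun [set: g_sigma_algebraType Fs] (g : g_sigma_algebraType Fs -> R).
Proof.
by move=> sF; rewrite -borel_measurable_fun /measurable /= sigma_algebra_id.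
Qed.

Lemma continuous_dist (R : realType) (X : normedModType R) (x : X) :
  continuous (fun z : X => `|z - x|).
Proof.
move=> z; apply: (@continuous_comp _ _ _ (fun z => z - x) (fun z => `|z|)).
  by apply: cvgB; [exact: cvg_id|exact: cvg_cst].
exact: norm_continuous.
Qed.

End borel_measurable.

Lemma dense_sequence (R : realType) (X : normedModType R) : separable X ->
  exists x_ : nat -> X, forall x (e : R), 0 < e -> exists n, `|x - x_ n| < e.
Proof.
move=> [S cS dS]; have [h hinj] := countable_injP _ cS.
exists (fun n => xget 0 [set x | S x /\ h x = n]) => x e e0.
have [y [/= xy Sy]] : ball x e `&` S !=set0.
  by apply: dS; [exists x; exact: ballxx|exact: ball_open].
exists (h y); case: xgetP => [z _ [Sz hz]|/(_ y)]; last by case.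
rewrite -ball_normE /= in xy.
by rewrite (hinj z y) // inE.
Qed.

Lemma separable_real (R : realType) : separable R.
Proof.
exists (range (@ratr R)); last exact: dense_rat.
exact: sub_countable (card_image_le _ _) (countableP _).
Qed.

Lemma le_of_forall_gt1 (R : realType) (u v : \bar R) : (0 <= v)%E ->
  (forall th : R, 1 < th -> (u <= th%:E * v)%E) -> (u <= v)%E.
Proof.
move=> v0 h; have [u0|u0] := leP u 0%E; first exact: le_trans v0.
apply/lee_mul01Pr; first exact: ltW.
move=> r /andP[r0 r1]; have := h r^-1; rewrite invf_gt1 // => /(_ r1) h1.
have -> : v = (r%:E * (r^-1%:E * v))%E.
  by rewrite muleA -EFinM mulfV ?gt_eqF // mul1e.
by rewrite lee_pmul2l // lte_fin.
Qed.

Section integral_of_nonneg.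
Context (R : realType) (d : measure_display) (T : measurableType d)
  (mu : {measure set T -> \bar R}).
Implicit Types (A : set T) (U V : T -> R).

Lemma measurable_EFinS A U : measurable_fun [set: T] U ->
  measurable_fun A (fun w => (U w)%:E).
Proof. by move=> mU; apply/measurable_EFinP; exact: measurable_funTS. Qed.

Lemma le_integral_nonneg A U V : measurable A ->
    measurable_fun [set: T] U -> measurable_fun [set: T] V ->
    (forall w, 0 <= U w) -> (forall w, A w -> U w <= V w) ->
  (\int[mu]_(w in A) (U w)%:E <= \int[mu]_(w in A) (V w)%:E)%E.
Proof.
move=> mA mU mV U0 UV; apply: (ge0_le_integral mu mA _ (measurable_EFinS mU)
  (measurable_EFinS mV)) => w Aw; by rewrite lee_fin ?UV.
Qed.

Lemma integralZ_nonneg A U (k : R) : measurable A -> 0 <= k ->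
    measurable_fun [set: T] U -> (forall w, 0 <= U w) ->
  (\int[mu]_(w in A) (k * U w)%:E = k%:E * \int[mu]_(w in A) (U w)%:E)%E.
Proof.
move=> mA k0 mU U0; under eq_integral do rewrite EFinM.
rewrite ge0_integralZl_EFin //; first by move=> w _; rewrite lee_fin.
exact: measurable_EFinS.
Qed.

Lemma integral_nonneg_ge0 A U : (forall w, 0 <= U w) ->
  (0 <= \int[mu]_(w in A) (U w)%:E)%E.
Proof. by move=> U0; apply: integral_ge0 => w _; rewrite lee_fin. Qed.

End integral_of_nonneg.

Section cells.
Context (R : realType) (d : measure_display) (T : measurableType d)
  (mu : {measure set T -> \bar R}) (Fs : set (set T)).
Hypotheses (sFs : sigma_algebra setT Fs) (Fsm : Fs `<=` @measurable d T).
Implicit Types (U V : T -> R).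

Let Fs_setI (A B : set T) : Fs A -> Fs B -> Fs (A `&` B).
Proof.
rewrite -(sigma_algebra_id sFs) => FA FB.
exact: (@measurableI _ (g_sigma_algebraType Fs)).
Qed.

(** Only countable additivity is used, so the factor [th] found on small events
    is valid on all events even when the integrals are infinite. *)
Lemma integral_le_cells U V (th : R) (C : nat -> set T) : 0 <= th ->
    (forall w, 0 <= U w) -> (forall w, 0 <= V w) ->
    measurable_fun setT U -> measurable_fun setT V ->
    (forall k, Fs (C k)) -> \bigcup_k C k = setT ->
    (forall k A, Fs A -> A `<=` C k ->
      \int[mu]_(w in A) (U w)%:E <= th%:E * \int[mu]_(w in A) (V w)%:E)%E ->
  forall A, Fs A ->
    (\int[mu]_(w in A) (U w)%:E <= th%:E * \int[mu]_(w in A) (V w)%:E)%E.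
Proof.
move=> th0 U0 V0 mU mV FC Ccov h A FA.
pose B k := A `&` seqDU C k.
have FB k : Fs (B k).
  apply: Fs_setI => //; have := FC; rewrite -(sigma_algebra_id sFs) => FC'.
  exact: (@seqDU_measurable _ (g_sigma_algebraType Fs)).
have AB : A = \bigcup_k B k.
  by rewrite -setI_bigcupr -seqDU_bigcup_eq Ccov setIT.
have tB : trivIset setT B.
  apply: trivIset_setIl; exact: trivIset_seqDU.
have mB k : measurable (B k) by exact: Fsm.
have mA : measurable A by exact: Fsm.
have sum_cells (Z : T -> R) : measurable_fun setT Z -> (forall w, 0 <= Z w) ->
    (\int[mu]_(w in A) (Z w)%:E = \sum_(k <oo) \int[mu]_(w in B k) (Z w)%:E)%E.
  move=> mZ Z0; rewrite {1}AB ge0_integral_bigcup //; first exact: measurable_EFinS.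
  by move=> w _; rewrite lee_fin.
rewrite !sum_cells // -nneseriesZl; last first.
  by move=> k _; exact: integral_nonneg_ge0.
apply: lee_nneseries => k _.
  by move=> _; exact: integral_nonneg_ge0.
apply: (h k) => // w [_]; exact: subset_seqDU.
Qed.

(** The cells are the preimages of the balls of radius [e] about a dense
    sequence. *)
Lemma ball_cells (X : normedModType R) (f : T -> X) (e : R) : separable X ->
    borel_measurable Fs f -> 0 < e ->
  exists C : nat -> set T, [/\ forall k, Fs (C k), \bigcup_k C k = setT &
    forall k, exists x, forall w, C k w -> `|f w - x| < e].
Proof.
move=> /dense_sequence[x_ dx] mf e0.
exists (fun k => [set w | `|f w - x_ k| < e]); split.
- move=> k; apply: (mf [set y | `|y - x_ k| < e]).
  apply: sub_sigma_algebra.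
  have -> : [set y | `|y - x_ k| < e] = ball (x_ k) e.
    by apply/funext => y; rewrite -ball_normE /= distrC.
  exact: ball_open.
- apply/seteqP; split => // w _; have [k hk] := dx (f w) _ e0.
  by exists k.
- by move=> k; exists (x_ k).
Qed.

(** On a cell where [ln rho] varies by less than [2 * e], [rho] is a constant up
    to the factor [expR (2 * e)], and [e] is arbitrary. *)
Lemma integral_le_weight U V (rho : T -> R) :
    (forall w, 0 <= U w) -> (forall w, 0 <= V w) ->
    measurable_fun setT U -> measurable_fun setT V ->
    borel_measurable Fs rho -> (forall w, 0 < rho w) ->
    (forall A, Fs A ->
      \int[mu]_(w in A) (U w)%:E <= \int[mu]_(w in A) (V w)%:E)%E ->
  forall A, Fs A -> (\int[mu]_(w in A) (rho w * U w)%:E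
      <= \int[mu]_(w in A) (rho w * V w)%:E)%E.
Proof.
move=> U0 V0 mU mV mrho rho0 h A FA.
have mrho' : measurable_fun setT rho.
  by apply/borel_measurable_fun; exact: borel_measurableS mrho.
apply: le_of_forall_gt1.
  by apply: integral_ge0 => w _; rewrite lee_fin mulr_ge0 // ltW.
move=> th th1; have th0 : 0 < th by apply: lt_trans th1.
set e := ln th / 2; have e0 : 0 < e by rewrite divr_gt0 // ln_gt0.
have mln : borel_measurable Fs (fun w => ln (rho w)).
  apply/borel_measurable_sigma => //.
  apply: measurableT_comp; first exact: measurable_ln.
  by apply/borel_measurable_sigma.
have [C [FC CT Cx]] := ball_cells (@separable_real R) mln e0.
move: A FA; apply: (integral_le_cells (C := C)) => //.
- exact: ltW.
- by move=> w; rewrite mulr_ge0 // ltW.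
- by move=> w; rewrite mulr_ge0 // ltW.
- exact: measurable_funM.
- exact: measurable_funM.
move=> k A FA AC; have [x hx] := Cx k.
have mA : measurable A by exact: Fsm.
have hrho w : A w -> expR (x - e) <= rho w <= expR (x + e).
  move=> /AC /hx; rewrite ltr_norml => /andP[h1 h2].
  rewrite -[rho w]lnK ?posrE // !ler_expR; apply/andP; split; lra.
apply: (@le_trans _ _ (\int[mu]_(w in A) (expR (x + e) * U w)%:E)%E).
  apply: le_integral_nonneg => //.
  - exact: measurable_funM.
  - exact: measurable_funM.
  - by move=> w; rewrite mulr_ge0 // ltW.
  - by move=> w Aw; rewrite ler_wpM2r //; have /andP[] := hrho _ Aw.
rewrite integralZ_nonneg ?expR_ge0 //.
apply: (@le_trans _ _ ((expR (x + e))%:E * \int[mu]_(w in A) (V w)%:E)%E).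
  by apply: lee_wpmul2l; [rewrite lee_fin expR_ge0|exact: h].
rewrite -!integralZ_nonneg ?expR_ge0 ?(ltW th0) //.
- apply: le_integral_nonneg => //.
  + exact: measurable_funM.
  + by apply: measurable_funM => //; exact: measurable_funM.
  + by move=> w; rewrite mulr_ge0 // expR_ge0.
  + move=> w Aw; rewrite mulrA ler_wpM2r //.
    have -> : expR (x + e) = th * expR (x - e).
      rewrite -[th]lnK ?posrE // -expRD; congr expR; rewrite /e; lra.
    by rewrite ler_wpM2l ?(ltW th0) //; have /andP[] := hrho _ Aw.
- exact: measurable_funM.
- by move=> w; rewrite mulr_ge0 // ltW.
Qed.

End cells.

(** * Jensen's inequality for superlinear functionals *)

Section superlinear_sum.
Context (R : realType) (X : normedModType R) (q : X -> R) (L : R).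
Hypothesis sq : superlinear q.

Lemma superlinear_ge0 : 0 <= q 0.
Proof. by have := sq.2 0 0 (lexx 0); rewrite mul0r scale0r. Qed.

Lemma superlinear_sum (I : Type) (r : seq I) (a : I -> R) (y : I -> X) :
    (forall i, 0 <= a i) ->
  \sum_(i <- r) a i * q (y i) <= q (\sum_(i <- r) a i *: y i).
Proof.
move=> a0; elim: r => [|i r ih]; first by rewrite !big_nil superlinear_ge0.
rewrite !big_cons; apply: le_trans (sq.1 _ _).
by rewrite lerD // sq.2.
Qed.

Lemma superlinear_continuous : (forall v, - (L * `|v|) <= q v) -> continuous q.
Proof.
move=> qL x; apply/cvgrPdist_le => e e0; near=> y.
apply: (@le_trans _ _ (`|L| * `|x - y|)).
  have h (u v : X) : q u <= q v + `|L| * `|u - v|.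
    apply: (le_trans (superlinear_le sq qL u v)).
    by rewrite lerD2l ler_wpM2r // ler_norm.
  by have := h x y; have := h y x; rewrite (distrC y) ler_norml; lra.
apply: (@le_trans _ _ ((`|L| + 1) * `|x - y|)).
  by rewrite ler_wpM2r // lerDl.
have L0 : 0 < `|L| + 1 by rewrite ltr_pwDr.
rewrite mulrC -ler_pdivlMr //; near: y.
have eL : 0 < e / (`|L| + 1) by rewrite divr_gt0.
by apply: cvgr_dist_le eL; exact: cvg_id.
Unshelve. all: by end_near. Qed.

End superlinear_sum.

Section bochner.
Context (R : realType) (dT : measure_display) (T : measurableType dT)
  (P : probability T R) (X : normedModType R).
Implicit Types (f s : T -> X) (A : set T).

(** Handles functions of a Borel measurable vector and a simple one without
    asking for measurability of the pair. *)
Lemma measurable_simple_split s (Phi : X -> T -> R) : simple_vector s ->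
    (forall y, measurable_fun [set: T] (Phi y)) ->
  measurable_fun [set: T] (fun w => Phi (s w) w).
Proof.
move=> [fs ms] mPhi _ B mB; rewrite setTI.
have -> : (fun w => Phi (s w) w) @^-1` B =
    \bigcup_(y in range s) (s @^-1` [set y] `&` Phi y @^-1` B).
  apply/seteqP; split=> [w Bw|w [y _ [/= <- Bw]] //].
  by exists (s w) => //; exists w.
apply: fin_bigcup_measurable => // y _; apply: measurableI; first exact: ms.
by rewrite -[X in measurable X]setTI; exact: mPhi.
Qed.

Lemma measurable_simple_comp s (phi : X -> R) : simple_vector s ->
  measurable_fun [set: T] (phi \o s).
Proof. by move=> ss; apply: (measurable_simple_split (Phi := fun y _ => phi y)). Qed.

Lemma integral_simple_comp s A (phi : X -> R) : measurable A -> simple_vector s ->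
  (\int[P]_(w in A) (phi (s w))%:E =
   (\sum_(y \in range s) fine (P (A `&` s @^-1` [set y])) * phi y)%:E)%E.
Proof.
move=> mA ss; have [fs ms] := ss.
pose F y := A `&` s @^-1` [set y].
have mF y : measurable (F y) by apply: measurableI.
rewrite fsbig_finite //.
have AE : A = \big[setU/set0]_(y \in range s) F y.
  rewrite fsbig_setU //; apply/seteqP; split=> [w Aw|w [y _ []] //].
  by exists (s w) => //; exists w.
rewrite fsbig_finite // in AE.
rewrite {1}AE integral_bigsetU_EFin //; last 2 first.
- by move=> y z _ _ [w [[_ /= <-] [_ /= <-]]].
- by rewrite -AE; apply/measurable_EFinP; apply: measurable_funTS;
    exact: measurable_simple_comp.
rewrite -sumEFin; apply: eq_bigr => y _.
rewrite (eq_integral (cst (phi y)%:E)); last first.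
  by move=> w; rewrite inE => -[_ /= ->].
rewrite integral_cst // muleC EFinM fineK //.
exact: (fin_num_measure P _ (mF y)).
Qed.

Lemma integrable_simple_comp s A (phi : X -> R) : measurable A -> simple_vector s ->
  P.-integrable A (fun w => (phi (s w))%:E).
Proof.
move=> mA ss; apply/integrableP; split.
  by apply: measurable_EFinS; exact: measurable_simple_comp.
by rewrite (integral_simple_comp (fun y => `|phi y|) mA ss) ltry.
Qed.

(** On simple vectors, superlinearity is Jensen's inequality for finite sums. *)
Lemma simple_jensen s A (q : X -> R) x : measurable A -> simple_vector s ->
    superlinear q ->
  (\int[P]_(w in A) (q (s w - x))%:E
    <= (q (simple_integral P A s - fine (P A) *: x))%:E)%E.
Proof.
move=> mA ss sq; have [fs ms] := ss.
rewrite (integral_simple_comp (fun y => q (y - x)) mA ss) lee_fin fsbig_finite //.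
apply: (le_trans (superlinear_sum sq _ _ _)).
  by move=> y; exact: fine_ge0.
have -> : fine (P A) = \sum_(y \in range s) fine (P (A `&` s @^-1` [set y])).
  have := integral_simple_comp (fun=> 1) mA ss.
  rewrite (integral_cst P mA 1%E) mul1e => ->.
  by apply: eq_fsbigr => y _; rewrite mulr1.
rewrite /simple_integral !fsbig_finite // scaler_suml -sumrB.
by under eq_bigr do rewrite scalerBr.
Qed.

Lemma measurable_dist_simple f s : borel_measurable (@measurable _ T) f ->
  simple_vector s -> measurable_fun [set: T] (fun w => `|f w - s w|).
Proof.
move=> mf ss; apply: (measurable_simple_split (Phi := fun y w => `|f w - y|)) => // y.
apply/borel_measurable_fun.
exact: (borel_measurable_comp (continuous_dist (x := y)) mf).
Qed.

Lemma bochner_approx_near f (s_ : nat -> T -> X) (e : R) : bochner_approx P f s_ -> 0 < e ->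
  \forall n \near \oo, (\int[P]_w (`|f w - s_ n w|)%:E < e%:E)%E.
Proof.
move=> [_ cv] e0; apply: (cv [set y | (y < e%:E)%E]).
by apply: open_ereal_lt'; rewrite lte_fin.
Qed.

Lemma bochner_integrable_norm f : bochner_integrable P f ->
  P.-integrable [set: T] (fun w => (`|f w|)%:E).
Proof.
move=> [mf [s_ happ]].
have [n _ hn] := bochner_approx_near happ ltr01.
have := hn n (leqnn n) => /= {hn}; have ss := happ.1 n.
set s := s_ n in ss *; move=> lt1.
have mfs := measurable_dist_simple mf ss.
have i1 : P.-integrable [set: T] (fun w => (`|f w - s w|)%:E).
  apply/integrableP; split; first exact/measurable_EFinP.
  under eq_integral do rewrite /= normr_id.
  exact: lt_trans lt1 (ltry _).
have i2 := integrable_simple_comp (fun y => `|y|) measurableT ss.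
apply: le_integrable (integrableD measurableT i1 i2) => //.
  apply/measurable_EFinP; apply/borel_measurable_fun.
  by apply: borel_measurable_comp mf; exact: norm_continuous.
move=> w _ /=; rewrite lee_fin normr_id ger0_norm ?addr_ge0 //.
by rewrite -[f w in leLHS](subrK (s w)) ler_normD.
Qed.

(** A superlinear functional with this lower bound is Lipschitz, so that
    [simple_jensen] passes to the limit along the simple vectors that define the
    Bochner integral of [f]. *)
Lemma bochner_jensen f A I (q : X -> R) (L : R) x : measurable A ->
    bochner_integrable P f -> is_bochner_integral P A f I ->
    superlinear q -> 0 <= L -> (forall v, - (L * `|v|) <= q v) ->
  P.-integrable A (fun w => (q (f w - x))%:E) /\
  (\int[P]_(w in A) (q (f w - x))%:E <= (q (I - fine (P A) *: x))%:E)%E.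
Proof.
move=> mA intf [s_ happ cvI] sq L0 qL.
have mf := intf.1.
have cq := superlinear_continuous sq qL.
have mq : measurable_fun [set: T] (fun w => q (f w - x)).
  apply/borel_measurable_fun.
  apply: (borel_measurable_comp (q := fun z => q (z - x))) => // z.
  apply: (@continuous_comp _ _ _ (fun z => z - x) q); last exact: cq.
  by apply: cvgB; [exact: cvg_id|exact: cvg_cst].
have intA : P.-integrable A (fun w => (q (f w - x))%:E).
  have i1 := integrableZl measurableT L (bochner_integrable_norm intf).
  have i2 := finite_measure_integrable_cst P (L * `|x|) (@measurableT _ T).
  apply: (integrableS measurableT) => //.
  apply: le_integrable (integrableD measurableT i1 i2) => //.
    exact/measurable_EFinP.
  move=> w _ /=; rewrite lee_fin -mulrDr [leRHS]ger0_norm ?mulr_ge0 ?addr_ge0 //.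
  apply: (le_trans (superlinear_norm_le sq qL _)).
  by rewrite ler_wpM2l // ler_normB.
split => //; apply/lee_addgt0Pr => e e0.
(* both passages to the limit, in the integral and in [I], cost [L * e'] *)
set e' := e / (2 * (L + 1)).
have e'0 : 0 < e' by rewrite divr_gt0 // mulr_gt0 // ltr_wpDl.
have near_s := bochner_approx_near happ e'0.
have near_I : \forall n \near \oo, `|simple_integral P A (s_ n) - I| < e'.
  by under eq_near do rewrite distrC; exact: cvgr_dist_lt e'0.
have [n [/= hs hI]] := filter_ex (filterI near_s near_I).
have ss := happ.1 n; set s := s_ n in ss hs hI.
have mfs := measurable_dist_simple mf ss.
have i1 : P.-integrable A (fun w => (`|f w - s w|)%:E).
  apply: (integrableS measurableT) => //.
  apply/integrableP; split; first exact/measurable_EFinP.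
  under eq_integral do rewrite /= normr_id.
  exact: lt_trans hs (ltry _).
have i2 := integrable_simple_comp (fun y => q (y - x)) mA ss.
have i3 := integrableZl mA L i1.
apply: (@le_trans _ _ (\int[P]_(w in A) ((q (s w - x))%:E + L%:E * (`|f w - s w|)%:E))%E).
  apply: le_integral => //; first exact: integrableD.
  move=> w _; rewrite -EFinM -EFinD lee_fin.
  apply: (le_trans (superlinear_le sq qL _ (s w - x))).
  by rewrite opprB addrA subrK.
rewrite integralD // integralZl //.
have h1 : (\int[P]_(w in A) (`|f w - s w|)%:E <= e'%:E)%E.
  apply: le_trans (ltW hs); apply: ge0_subset_integral => //.
  exact/measurable_EFinP.
have h2 := simple_jensen x mA ss sq.
apply: (le_trans (leeD h2 (lee_wpmul2l _ h1))); first by rewrite lee_fin.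
rewrite -EFinM -!EFinD lee_fin.
have := superlinear_le sq qL (simple_integral P A s - fine (P A) *: x) (I - fine (P A) *: x).
rewrite opprB addrA subrK => h3.
have h4 : L * `|simple_integral P A s - I| <= L * e' by rewrite ler_wpM2l // ltW.
have h5 : 2 * (L * e') <= e.
  have -> : e = 2 * ((L + 1) * e') by rewrite /e'; field; rewrite gt_eqF // ltr_wpDl.
  by rewrite ler_pM2l // ler_wpM2r ?(ltW e'0) // lerDl.
lra.
Qed.

End bochner.

(** * One step of the martingale *)

(** [`|g w - f w|] is the infimum of [`|g w - x_k| + `|f w - x_k|] over a dense
    sequence; this is where separability makes the increments measurable. *)
Lemma measurable_dist (R : realType) (X : normedModType R) (d : measure_display)
    (T : measurableType d) (f g : T -> X) : separable X ->
    borel_measurable (@measurable d T) f -> borel_measurable (@measurable d T) g ->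
  measurable_fun [set: T] (fun w => `|g w - f w|).
Proof.
move=> /dense_sequence[x_ dx] mf mg mT.
apply: (measurability _ (RGenInftyO.measurableE R)) => // _ [_ [a ->] <-].
rewrite setTI.
have mdist h k : borel_measurable (@measurable d T) h ->
    measurable_fun [set: T] (fun w => `|h w - x_ k|).
  move=> mh; apply/borel_measurable_fun.
  exact: (borel_measurable_comp (continuous_dist (x := x_ k)) mh).
have -> : (fun w => `|g w - f w|) @^-1` `]-oo, a[ =
    \bigcup_k (fun w => `|g w - x_ k| + `|f w - x_ k|) @^-1` `]-oo, a[.
  apply/seteqP; split => w /=; rewrite ?in_itv /=.
    move=> gfa; set e := (a - `|g w - f w|) / 2.
    have e0 : 0 < e by rewrite divr_gt0 // subr_gt0.
    have [k hk] := dx (f w) _ e0; exists k => //=; rewrite in_itv /=.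
    have : `|g w - x_ k| <= `|g w - f w| + `|f w - x_ k|.
      by rewrite -(subrKA (f w)) ler_normD.
    rewrite /e in hk; lra.
  move=> [k _ /=]; rewrite in_itv /=; apply: le_lt_trans.
  by rewrite -(subrKA (x_ k)) (le_trans (ler_normD _ _)) // (distrC (x_ k)).
apply: bigcup_measurable => k _.
rewrite -[X in measurable X]setTI.
by apply: measurable_funD => //; exact: mdist.
Qed.

Section one_step.
Context (R : realType) (X : normedModType R) (dT : measure_display)
  (T : measurableType dT) (P : probability T R) (Psi : X -> R) (D lam : R)
  (Fs : set (set T)) (f g : T -> X) (c : T -> R).
Hypotheses (sepX : separable X) (D_ge1 : 1 <= D) (smoothPsi : smooth2 D Psi)
  (lam_gt0 : 0 < lam) (sFs : sigma_algebra setT Fs)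
  (Fsm : Fs `<=` @measurable dT T)
  (intf : bochner_integrable P f) (intg : bochner_integrable P g)
  (condf : bochner_cond_expectation P Fs g f)
  (exp_lty : (\int[P]_w (expR (lam * `|g w - f w|))%:E < +oo)%E)
  (condc : cond_expectation P Fs (fun w => expR_rem (lam * `|g w - f w|)) c).

Local Notation G := (cosh_of Psi lam).
Local Notation kappa := (superdiff_lip D lam).
Local Notation h := (fun w => expR_rem (lam * `|g w - f w|)).

Let mdist : measurable_fun [set: T] (fun w => `|g w - f w|).
Proof. by apply: measurable_dist => //; [exact: intf.1|exact: intg.1]. Qed.

Let mc : measurable_fun [set: T] c.
Proof.
by apply/borel_measurable_fun; case: condc => mc _ _; exact: borel_measurableS mc.
Qed.

Let mG (k : T -> X) : borel_measurable (@measurable dT T) k ->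
  measurable_fun [set: T] (fun w => G (k w)).
Proof.
move=> mk; apply/borel_measurable_fun.
exact: (borel_measurable_comp (continuous_cosh_of smoothPsi)).
Qed.

Lemma integrable_jump : P.-integrable [set: T] (fun w => (h w)%:E).
Proof.
have mh : measurable_fun [set: T] h.
  by apply: measurable_funB;
    [apply: measurable_funB => //; apply: measurableT_comp => //|]; exact: measurable_funM.
apply/integrableP; split; first exact/measurable_EFinP.
apply: le_lt_trans exp_lty.
under eq_integral do rewrite /= ger0_norm ?expR_rem_ge0 //.
apply: le_integral_nonneg => //.
- by apply: measurableT_comp => //; exact: measurable_funM.
- by move=> w; exact: expR_rem_ge0.
- move=> w _; rewrite /expR_rem.
  have : 0 <= lam * `|g w - f w| by rewrite mulr_ge0 // ltW.
  lra.
Qed.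

(** The superdifferential is evaluated at [g w - x] instead of the increment
    [g w - f w], so that Jensen's inequality is needed for the Bochner integral
    of [g] alone; the difference is [kappa * G x * e] at most. *)
Lemma one_step_pointwise x (e : R) w : `|f w - x| <= e ->
  G (g w) <= expR (lam * e) * (G x + kappa * G x * e
    + superdiff Psi D lam x (g w - x) + D ^+ 2 * G x * h w).
Proof.
move=> fx; set q := superdiff Psi D lam x.
have G0 := cosh_of_gt0 Psi lam x.
have sq : superlinear q by exact: superlinear_superdiff.
have qL := superdiff_lower D_ge1 smoothPsi lam_gt0 x.
have up := superdiff_upper D_ge1 smoothPsi lam_gt0 x (g w - f w).
have h1 := superlinear_le sq qL (g w - f w) (g w - x).
have e1 : g w - f w - (g w - x) = - (f w - x).
  by rewrite opprB addrC subrKA opprB.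
rewrite e1 normrN in h1.
have h2 : kappa * G x * `|f w - x| <= kappa * G x * e.
  by rewrite ler_wpM2l // mulr_ge0 ?(ltW G0) // superdiff_lip_ge0.
apply: (le_trans (cosh_of_le smoothPsi lam_gt0 (x + (g w - f w)) (g w))).
have -> : g w - (x + (g w - f w)) = f w - x.
  by rewrite opprD opprB addrCA subrKC addrC.
apply: ler_pM; [exact: expR_ge0|exact: ltW (cosh_of_gt0 _ _ _)| |].
  by rewrite ler_expR ler_pM2l.
rewrite -/q in up; lra.
Qed.

(** By Jensen's inequality the integral of the first-order term is at most the
    superdifferential at [I - P A *: x], where [I] is the common Bochner integral
    of [f] and [g] over [A]; Jensen's inequality for [- `|v|] and the integral of
    [f] bound the norm of this vector by [e * P A].  In the constant, [2 * lam]
    accounts for replacing [f w] by [x] and back inside [G], and [2 * kappa] for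
    the two errors in the first-order term. *)
Lemma one_step_cell x (e : R) A : 0 < e -> Fs A -> (forall w, A w -> `|f w - x| < e) ->
  (\int[P]_(w in A) (G (g w))%:E <= (expR (2 * (lam + kappa) * e))%:E *
    \int[P]_(w in A) ((1 + D ^+ 2 * Num.max 0 (c w)) * G (f w))%:E)%E.
Proof.
move=> e0 FA Ax; have mA : measurable A by exact: Fsm.
set q := superdiff Psi D lam x.
have G0 := cosh_of_gt0 Psi lam x.
have sq : superlinear q by exact: superlinear_superdiff.
have qL := superdiff_lower D_ge1 smoothPsi lam_gt0 x.
have k0 : 0 <= kappa by exact: superdiff_lip_ge0.
have L0 : 0 <= kappa * G x by rewrite mulr_ge0 // ltW.
have [_ _ /(_ A FA)[I gI fI]] := condf.
have [intq jq] := bochner_jensen x mA intg gI sq L0 qL.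
have sN : superlinear (fun v : X => - `|v|).
  split=> [v w|a v a0]; first by have := ler_normD v w; lra.
  by rewrite normrZ ger0_norm // mulrN.
have NL (v : X) : - (1 * `|v|) <= - `|v| by rewrite mul1r.
have [intN jN] := bochner_jensen x mA intf fI sN ler01 NL.
set p := fine (P A) in jq jN.
have PA : P A = p%:E by rewrite fineK // fin_num_measure.
have cstA (k : R) : (\int[P]_(w in A) k%:E = (k * p)%:E)%E.
  rewrite EFinM -PA; exact: (integral_cst P mA).
have p0 : 0 <= p by exact: fine_ge0.
have Ip : `|I - p *: x| <= e * p.
  have : ((- (e * p))%:E <= \int[P]_(w in A) (- `|f w - x|)%:E)%E.
    rewrite -mulNr -cstA; apply: le_integral => //.
      exact: finite_measure_integrable_cst.
    by move=> w; rewrite inE => /Ax /ltW fx; rewrite /= lee_fin lerN2.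
  by move=> /le_trans /(_ jN); rewrite lee_fin lerN2.
have {}jq : (\int[P]_(w in A) (q (g w - x))%:E <= (kappa * G x * (e * p))%:E)%E.
  apply: (le_trans jq); rewrite lee_fin.
  apply: (le_trans (ler_norm _)); apply: (le_trans (superlinear_norm_le sq qL _)).
  by rewrite ler_wpM2l.
have [_ intc /(_ A FA) eqc] := condc.
have mcp : measurable_fun [set: T] (fun w => Num.max 0 (c w)).
  by apply: measurable_maxr.
have cp0 w : 0 <= Num.max 0 (c w) by rewrite le_max lexx.
have intcp : P.-integrable A (fun w => (Num.max 0 (c w))%:E).
  apply: (integrableS measurableT) => //; apply: le_integrable intc => //.
    exact/measurable_EFinP.
  move=> w _ /=; rewrite lee_fin ger0_norm // ge_max normr_ge0 /=.
  exact: ler_norm.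
have intcA : P.-integrable A (fun w => (c w)%:E) by exact: (integrableS measurableT).
have inthA : P.-integrable A (fun w => (h w)%:E).
  by apply: (integrableS measurableT) => //; exact: integrable_jump.
set H := fine (\int[P]_(w in A) (Num.max 0 (c w))%:E).
have HE : (\int[P]_(w in A) (Num.max 0 (c w))%:E = H%:E)%E.
  by rewrite fineK // integrable_fin_num.
have H0 : 0 <= H by apply: fine_ge0; exact: integral_nonneg_ge0.
have hH : (\int[P]_(w in A) (h w)%:E <= H%:E)%E.
  rewrite -eqc -HE; apply: le_integral => // w _.
  by rewrite lee_fin le_max lexx orbT.
have lower : ((G x * (p + D ^+ 2 * H))%:E <= (expR (lam * e))%:E *
    \int[P]_(w in A) ((1 + D ^+ 2 * Num.max 0 (c w)) * G (f w))%:E)%E.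
  have mw : measurable_fun [set: T] (fun w => 1 + D ^+ 2 * Num.max 0 (c w)).
    by apply: measurable_funD => //; exact: measurable_funM.
  have w0 w : 0 <= 1 + D ^+ 2 * Num.max 0 (c w).
    by rewrite addr_ge0 // mulr_ge0 // sqr_ge0.
  have -> : ((G x * (p + D ^+ 2 * H))%:E =
      \int[P]_(w in A) (G x * (1 + D ^+ 2 * Num.max 0 (c w)))%:E)%E.
    rewrite integralZ_nonneg ?(ltW G0) // EFinM; congr (_ * _)%E.
    under eq_integral do rewrite EFinD.
    rewrite integralD //; last 2 first.
    - exact: finite_measure_integrable_cst.
    - under eq_fun do rewrite EFinM; exact: integrableZl.
    rewrite cstA mul1r integralZ_nonneg ?sqr_ge0 // HE.
    by rewrite EFinD EFinM.
  rewrite -integralZ_nonneg ?expR_ge0 //.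
  - apply: le_integral_nonneg => //.
    + exact: measurable_funM.
    + by apply: measurable_funM => //; apply: measurable_funM => //; apply: mG; exact: intf.1.
    + by move=> w; rewrite mulr_ge0 // ltW.
    + move=> w Aw; rewrite mulrCA mulrC ler_wpM2l //.
      apply: (le_trans (cosh_of_le smoothPsi lam_gt0 (f w) x)).
      rewrite ler_wpM2r ?(ltW (cosh_of_gt0 _ _ _)) // ler_expR ler_pM2l //.
      by rewrite distrC ltW // Ax.
  - by apply: measurable_funM => //; apply: mG; exact: intf.1.
  - by move=> w; rewrite mulr_ge0 // ltW // cosh_of_gt0.
have upper : (\int[P]_(w in A) (G (g w))%:E <=
    (expR (lam * e) * ((1 + 2 * kappa * e) * (G x * (p + D ^+ 2 * H))))%:E)%E.
  set K := G x + kappa * G x * e.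
  have i1 := finite_measure_integrable_cst P K mA.
  have i2 := integrableD mA i1 intq.
  have i3 := integrableZl mA (D ^+ 2 * G x) inthA.
  have i4 := integrableD mA i2 i3.
  have i5 := integrableZl mA (expR (lam * e)) i4.
  have /integrableP[m5 _] := i5.
  apply: (le_trans (ge0_le_integral P mA _ _ m5 _)).
  - by move=> w _; rewrite lee_fin ltW // cosh_of_gt0.
  - by apply: measurable_EFinS; apply: mG; exact: intg.1.
  - by move=> w Aw; have := one_step_pointwise (ltW (Ax _ Aw)); rewrite -lee_fin.
  rewrite integralZl // integralD // integralD // integralZl // cstA.
  rewrite [leRHS]EFinM; apply: lee_wpmul2l; first by rewrite lee_fin expR_ge0.
  apply: (@le_trans _ _ ((K * p)%:E + (kappa * G x * (e * p))%:E + (D ^+ 2 * G x)%:E * H%:E)%E).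
    apply: leeD; first exact: leeD.
    by apply: lee_wpmul2l => //; rewrite lee_fin mulr_ge0 ?sqr_ge0 // ltW.
  rewrite -!EFinM -!EFinD lee_fin /K.
  have : 0 <= 2 * kappa * e * (G x * (D ^+ 2 * H)).
    apply: mulr_ge0; first by rewrite mulr_ge0 ?(ltW e0) // mulr_ge0.
    by rewrite mulr_ge0 ?(ltW G0) // mulr_ge0 // sqr_ge0.
  lra.
apply: (le_trans upper).
have -> : expR (2 * (lam + kappa) * e) =
    expR (lam * e) * expR (2 * kappa * e) * expR (lam * e).
  by rewrite -!expRD; congr expR; ring.
rewrite [in leRHS]EFinM -muleA.
apply: (@le_trans _ _ ((expR (lam * e) * expR (2 * kappa * e))%:E *
  (G x * (p + D ^+ 2 * H))%:E)%E).
  rewrite -EFinM lee_fin -[leRHS]mulrA ler_wpM2l ?expR_ge0 // ler_wpM2r ?expR_ge1Dx //.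
  by rewrite mulr_ge0 ?(ltW G0) // addr_ge0 // mulr_ge0 // sqr_ge0.
by rewrite lee_wpmul2l // lee_fin mulr_ge0 ?expR_ge0.
Qed.

(** The events on which [f] is close to a point cover everything, and the
    factor of [one_step_cell] tends to 1 with the size [e] of the cells. *)
Lemma one_step A : Fs A -> (\int[P]_(w in A) (G (g w))%:E
  <= \int[P]_(w in A) ((1 + D ^+ 2 * Num.max 0 (c w)) * G (f w))%:E)%E.
Proof.
move=> FA; have mA : measurable A by exact: Fsm.
have V0 w : 0 <= (1 + D ^+ 2 * Num.max 0 (c w)) * G (f w).
  rewrite mulr_ge0 ?(ltW (cosh_of_gt0 _ _ _)) // addr_ge0 // mulr_ge0 ?sqr_ge0 //.
  by rewrite le_max lexx.
apply: le_of_forall_gt1; first exact: integral_nonneg_ge0.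
move=> th th1; have th0 : 0 < th by apply: lt_trans th1.
have k0 : 0 < 2 * (lam + kappa).
  by rewrite mulr_gt0 // ltr_wpDr // superdiff_lip_ge0.
have e0 : 0 < ln th / (2 * (lam + kappa)) by rewrite divr_gt0 // ln_gt0.
set e := ln th / _ in e0.
have [C [FC CT Cx]] : exists C : nat -> set T, [/\ forall k, Fs (C k),
    \bigcup_k C k = setT & forall k, exists x, forall w, C k w -> `|f w - x| < e].
  by apply: ball_cells => //; case: condf.
move: A FA {mA}; apply: (integral_le_cells sFs Fsm (C := C)) => //.
- exact: ltW.
- by move=> w; rewrite ltW // cosh_of_gt0.
- by apply: mG; exact: intg.1.
- apply: measurable_funM; last by apply: mG; exact: intf.1.
  by apply: measurable_funD => //; apply: measurable_funM => //; exact: measurable_maxr.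
move=> k A FA AC; have [x hx] := Cx k.
have := one_step_cell e0 FA (fun w Aw => hx w (AC w Aw)).
by rewrite /e mulrC divfK ?gt_eqF // lnK.
Qed.

End one_step.

(** * Ville's maximal inequality *)

Section ville.
Context (R : realType) (dT : measure_display) (T : measurableType dT)
  (P : probability T R) (F : nat -> set (set T)) (Z : nat -> T -> R).
Hypotheses (filtF : filtration F) (Z_ge0 : forall n w, 0 <= Z n w)
  (mZ : forall n, borel_measurable (F n) (Z n))
  (superZ : forall n A, F n A ->
    (\int[P]_(w in A) (Z n.+1 w)%:E <= \int[P]_(w in A) (Z n w)%:E)%E).

Let sF n : sigma_algebra setT (F n). Proof. by case: filtF. Qed.

Let mF n : F n `<=` @measurable dT T. Proof. by case: filtF. Qed.

Let mZT n : measurable_fun [set: T] (Z n).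
Proof. by apply/borel_measurable_fun; exact: borel_measurableS (mZ n). Qed.

(** [E n] is the event that the level [th] has been reached by time [n].  The
    expectation of [Z] on the complement of [E n], plus [th] times the probability
    of [E n], cannot increase with [n]: what leaves the complement at time [n.+1]
    carries a value of at least [th]. *)
Lemma ville (th : R) : 0 < th ->
  (th%:E * P (\bigcup_n [set w | (th <= Z n w)%R]) <= \int[P]_w (Z 0%N w)%:E)%E.
Proof.
move=> th0; pose S n := [set w | th <= Z n w].
pose E n := \big[setU/set0]_(i < n.+1) S i.
have FS n : F n (S n).
  have -> : S n = Z n @^-1` `[th, +oo[.
    by apply/seteqP; split => w; rewrite /S /= in_itv /= andbT.
  apply: mZ; rewrite -measurable_borelE; exact: measurable_itv.
have EsS n : E n.+1 = E n `|` S n.+1 by rewrite /E big_ord_recr.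
have FE n : F n (E n).
  elim: n => [|n ih]; first by rewrite /E big_ord_recl big_ord0 setU0; exact: FS.
  rewrite EsS; have := FS n.+1; have : F n.+1 (E n) by case: filtF => _ _; apply.
  rewrite -(sigma_algebra_id (sF n.+1)).
  exact: (@measurableU _ (g_sigma_algebraType (F n.+1))).
have FCE n : F n (~` E n).
  have := FE n; rewrite -(sigma_algebra_id (sF n)).
  exact: (@measurableC _ (g_sigma_algebraType (F n))).
have mS n : measurable (S n) := mF (FS n).
have mE n : measurable (E n) := mF (FE n).
have th_le B n : measurable B -> B `<=` S n ->
    (th%:E * P B <= \int[P]_(w in B) (Z n w)%:E)%E.
  move=> mB BS; rewrite -(integral_cst P mB).
  by apply: (le_integral_nonneg P mB (U := cst th)) => // w; exact: ltW.
have splitE n B C : measurable B -> measurable C -> [disjoint B & C] ->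
    (\int[P]_(w in B `|` C) (Z n w)%:E =
     \int[P]_(w in B) (Z n w)%:E + \int[P]_(w in C) (Z n w)%:E)%E.
  move=> mB mC BC; apply: ge0_integral_setU => //; first exact: measurable_EFinS.
  by move=> w _; rewrite lee_fin.
have key n : (\int[P]_(w in ~` E n) (Z n w)%:E + th%:E * P (E n)
    <= \int[P]_w (Z 0%N w)%:E)%E.
  elim: n => [|n ih].
    have E0 : E 0%N = S 0%N by rewrite /E big_ord_recl big_ord0 setU0.
    rewrite -(setvU (E 0%N)) splitE //; last 2 first.
    - exact: measurableC.
    - by apply/disj_setPS; rewrite setICl.
    by rewrite leeD2l // th_le // E0.
  apply: le_trans ih; set B := ~` E n `&` S n.+1.
  have mB : measurable B by apply: measurableI => //; exact: measurableC.
  have e1 : ~` E n = ~` E n.+1 `|` B.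
    rewrite EsS setCU /B -setIUr; apply/seteqP; split => w //=.
    by move=> Ew; split => //; have [|] := pselect (S n.+1 w); [right|left].
    by case.
  have e2 : E n.+1 = E n `|` B.
    by rewrite EsS /B setUIr setUCr setTI.
  have d1 : [disjoint ~` E n.+1 & B].
    by apply/disj_setPS; rewrite EsS setCU /B => w [[_ ?] [_ ?]].
  have d2 : E n `&` B = set0 by rewrite /B setIA setICr set0I.
  have PE : (P (E n.+1) = P (E n) + P B)%E by rewrite e2 measureU.
  rewrite PE ge0_muleDr // [(th%:E * P (E n) + _)%E]addeC addeA.
  apply: leeD => //; apply: le_trans (superZ (FCE n)).
  rewrite e1 splitE //; last exact: measurableC.
  by rewrite leeD2l // th_le // => w [].
rewrite -bigcup_bigsetU_bigcup.
have mUE : measurable (\bigcup_n E n) by exact: bigcup_measurable.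
have ndE : {homo E : n m / (n <= m)%N >-> (n <= m)%O}.
  by apply/nondecreasing_seqP => n; rewrite EsS; apply/subsetPset; left.
have cvE := nondecreasing_cvg_mu (mu := P) mE mUE ndE.
rewrite muleC -lee_pdivlMr //.
apply: (cvge_to_le cvE); near=> n.
rewrite lee_pdivlMr // muleC; apply: le_trans (key n).
by rewrite leeDr // integral_nonneg_ge0.
Unshelve. all: by end_near. Qed.

End ville.

(** * The tail bound *)

Lemma smooth2_le (R : realType) (X : normedModType R) (D D' : R) (Psi : X -> R) :
  0 <= D -> D <= D' -> smooth2 D Psi -> smooth2 D' Psi.
Proof.
move=> D0 DD' [P0 P00 P1 P2]; split=> // x v.
apply: (le_trans (P2 x v)); rewrite ler_wpM2r ?sqr_ge0 // ler_wpM2l //.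
by rewrite lerXn2r // nnegrE // (le_trans D0).
Qed.

(** The integral of [c] over the event [c < 0] is that of [h], hence both
    nonpositive and nonnegative. *)
Lemma cond_expectation_ge0 (R : realType) (dT : measure_display)
    (T : measurableType dT) (P : probability T R) (Fs : set (set T)) (h c : T -> R) :
    Fs `<=` @measurable dT T -> (forall w, 0 <= h w) -> cond_expectation P Fs h c ->
  \forall w \ae P, 0 <= c w.
Proof.
move=> Fsm h0 [mc intc eqc].
pose A := c @^-1` `]-oo, 0[.
have FA : Fs A by apply: mc; rewrite -measurable_borelE; exact: measurable_itv.
have mA := Fsm _ FA.
have c0 w : A w -> c w < 0 by rewrite /A /= in_itv.
have intcA : P.-integrable A (fun w => (c w)%:E) by exact: (integrableS measurableT).
have /integrableP[mcA _] := intcA.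
have eq0 : (\int[P]_(w in A) `|(c w)%:E| = 0)%E.
  apply/eqP; rewrite eq_le; apply/andP; split; last exact: integral_ge0.
  rewrite (eq_integral (fun w => - (c w)%:E)%E); last first.
    by move=> w; rewrite inE => /c0 cw; rewrite /= ltr0_norm.
  rewrite integralN; last exact: integrable_add_def.
  by rewrite oppe_le0 eqc // integral_nonneg_ge0.
have /(ae_eq_integral_abs _ mA mcA) := eq0.
apply: filterS => w h1; rewrite leNgt; apply/negP => cw.
have Aw : A w by rewrite /A /= in_itv.
by have [e] := h1 Aw; rewrite e ltxx in cw.
Qed.

Section tail_bound.
Context (R : realType) (X : normedModType R) (dT : measure_display)
  (T : measurableType dT) (P : probability T R) (F : nat -> set (set T))
  (f : nat -> T -> X) (Psi : X -> R) (D lam : R) (c : nat -> T -> R).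
Hypotheses (sepX : separable X) (martf : martingale0 P F f)
  (lam_gt0 : 0 < lam) (D_ge1 : 1 <= D) (smoothPsi : smooth2 D Psi)
  (expd : forall j, (1 <= j)%N ->
     (\int[P]_w (expR (lam * `|mdiff f j w|))%:E < +oo)%E)
  (condc : forall j, (1 <= j)%N ->
     cond_expectation P (F j.-1) (fun w => expR_rem (lam * `|mdiff f j w|)) (c j)).

Local Notation G := (cosh_of Psi lam).

(** The partial products of the theorem, with the almost surely nonnegative [c j]
    truncated at 0, so that every factor is at least 1 everywhere and not only
    almost everywhere. *)
Definition growth n w : R := \prod_(1 <= j < n.+1) (1 + D ^+ 2 * Num.max 0 (c j w)).

Lemma growth0 w : growth 0 w = 1.
Proof. by rewrite /growth big_geq. Qed.

Lemma growthS n w :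
  growth n.+1 w = growth n w * (1 + D ^+ 2 * Num.max 0 (c n.+1 w)).
Proof. by rewrite /growth big_nat_recr. Qed.

Lemma growth_factor_ge1 j w : 1 <= 1 + D ^+ 2 * Num.max 0 (c j w).
Proof. by rewrite lerDl mulr_ge0 ?sqr_ge0 // le_max lexx. Qed.

Lemma growth_ge1 n w : 1 <= growth n w.
Proof.
elim: n => [|n ih]; first by rewrite growth0.
by rewrite growthS mulr_ege1 // growth_factor_ge1.
Qed.

Lemma growth_gt0 n w : 0 < growth n w.
Proof. exact: lt_le_trans (growth_ge1 n w). Qed.

Let filtF : filtration F. Proof. by case: martf. Qed.

Let sF n : sigma_algebra setT (F n). Proof. by case: filtF. Qed.

Let mF n : F n `<=` @measurable dT T. Proof. by case: filtF. Qed.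

(** Predictability is what allows [(growth n.+1)^-1] to serve as the weight in
    [integral_le_weight] at step [n]. *)
Lemma growth_predictable n : borel_measurable (F n) (growth n.+1).
Proof.
elim: n => [|n ih]; apply/borel_measurable_sigma => //.
  have mc1 : measurable_fun [set: g_sigma_algebraType (F 0%N)] (c 1%N).
    by apply/borel_measurable_sigma => //; case: (condc (ltn0Sn 0)).
  rewrite (_ : growth 1 = fun w => 1 + D ^+ 2 * Num.max 0 (c 1%N w)); last first.
    by apply/funext => w; rewrite growthS growth0 mul1r.
  by apply: measurable_funD => //; apply: measurable_funM => //; exact: measurable_maxr.
have mcn : measurable_fun [set: g_sigma_algebraType (F n.+1)] (c n.+2).
  by apply/borel_measurable_sigma => //; case: (condc (ltn0Sn n.+1)).
have mg : measurable_fun [set: g_sigma_algebraType (F n.+1)] (growth n.+1).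
  apply/borel_measurable_sigma => //; apply: borel_measurableS ih.
  by case: filtF.
rewrite (_ : growth n.+2 = fun w => growth n.+1 w * (1 + D ^+ 2 * Num.max 0 (c n.+2 w))).
  apply: measurable_funM => //; apply: measurable_funD => //.
  by apply: measurable_funM => //; exact: measurable_maxr.
by apply/funext => w; rewrite growthS.
Qed.

Lemma growth_adapted n : borel_measurable (F n) (growth n).
Proof.
case: n => [|n]; last first.
  by apply: borel_measurableS (growth_predictable n); case: filtF.
apply/borel_measurable_sigma => //.
by rewrite (_ : growth 0 = cst 1) //; apply/funext => w; rewrite growth0.
Qed.

Definition normalized n w : R := (growth n w)^-1 * G (f n w).

Lemma borel_measurable_inv (Fs : set (set T)) (u : T -> R) : sigma_algebra setT Fs ->
    borel_measurable Fs u -> (forall w, 0 < u w) ->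
  borel_measurable Fs (fun w => (u w)^-1).
Proof.
move=> sFs mu u0; apply/borel_measurable_sigma => //.
rewrite (_ : (fun w => (u w)^-1) = fun w => expR (- ln (u w))); last first.
  by apply/funext => w; rewrite expRN lnK // posrE.
apply: measurableT_comp => //. apply: measurableT_comp => //.
apply: measurableT_comp; first exact: measurable_ln.
by apply/borel_measurable_sigma.
Qed.

Lemma normalized_adapted n : borel_measurable (F n) (normalized n).
Proof.
apply/borel_measurable_sigma => //; apply: measurable_funM.
  apply/borel_measurable_sigma => //; apply: borel_measurable_inv => //.
    exact: growth_adapted.
  exact: growth_gt0.
apply/borel_measurable_sigma => //.
apply: (borel_measurable_comp (continuous_cosh_of smoothPsi)).
by case: martf.
Qed.

Lemma normalized_ge0 n w : 0 <= normalized n w.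
Proof. by rewrite mulr_ge0 ?invr_ge0 // ltW // ?growth_gt0 ?cosh_of_gt0. Qed.

(** The weight [(growth n.+1)^-1] turns the factor gained in [one_step] into
    [(growth n)^-1]. *)
Lemma normalized_supermartingale n A : F n A ->
  (\int[P]_(w in A) (normalized n.+1 w)%:E <= \int[P]_(w in A) (normalized n w)%:E)%E.
Proof.
move=> FA; case: (martf) => _ _ mf intf condf.
have mG k : measurable_fun [set: T] (fun w => G (f k w)).
  apply/borel_measurable_fun.
  apply: (borel_measurable_comp (continuous_cosh_of smoothPsi)).
  exact: borel_measurableS (mf k).
have mcn : measurable_fun [set: T] (c n.+1).
  apply/borel_measurable_fun; case: (condc (ltn0Sn n)) => mc _ _.
  exact: borel_measurableS mc.
have step B := @one_step R X dT T P Psi D lam (F n) (f n) (f n.+1) (c n.+1)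
  sepX D_ge1 smoothPsi lam_gt0 (sF n) (@mF n) (intf n) (intf n.+1) (condf n)
  (expd (ltn0Sn n)) (condc (ltn0Sn n)) B.
have mV : measurable_fun [set: T]
    (fun w => (1 + D ^+ 2 * Num.max 0 (c n.+1 w)) * G (f n w)).
  apply: measurable_funM => //; apply: measurable_funD => //.
  by apply: measurable_funM => //; exact: measurable_maxr.
have V0 w : 0 <= (1 + D ^+ 2 * Num.max 0 (c n.+1 w)) * G (f n w).
  rewrite mulr_ge0 ?(ltW (cosh_of_gt0 _ _ _)) //.
  exact: le_trans (growth_factor_ge1 _ _).
have mrho := borel_measurable_inv (sF n) (growth_predictable n) (growth_gt0 n.+1).
have rho0 w : 0 < (growth n.+1 w)^-1 by rewrite invr_gt0 growth_gt0.
apply: (le_trans (integral_le_weight (sF n) (@mF n) _ V0 (mG n.+1) mV mrho rho0 step FA)).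
  by move=> w; exact: ltW (cosh_of_gt0 _ _ _).
rewrite le_eqVlt; apply/orP; left; apply/eqP; apply: eq_integral => w _.
rewrite /normalized growthS invfM; congr EFin.
rewrite mulrA -[_^-1 * _^-1 * _]mulrA mulVf ?mulr1 //.
by rewrite gt_eqF // (lt_le_trans _ (growth_factor_ge1 _ _)).
Qed.

Lemma normalized_tail (th : R) : 0 < th ->
  (P (\bigcup_n [set w | (th <= normalized n w)%R]) <= (th^-1)%:E)%E.
Proof.
move=> th0.
have := ville filtF normalized_ge0 normalized_adapted normalized_supermartingale th0.
have -> : (\int[P]_w (normalized 0 w)%:E = 1)%E.
  rewrite (eq_integral (cst 1%E)).
    by rewrite integral_cst // mul1e; exact: probability_setT.
  move=> w _; rewrite /normalized growth0 invr1 mul1r.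
  case: (martf) => _ -> _ _ _; case: smoothPsi => _ P00 _ _.
  by rewrite /cosh_of P00 mulr0 cosh0.
by rewrite muleC -lee_pdivlMr // mul1e.
Qed.

Lemma measurable_Psi n : measurable_fun [set: T] (fun w => Psi (f n w)).
Proof.
apply/borel_measurable_fun.
apply: (borel_measurable_comp (continuous_Psi smoothPsi)).
by case: martf => _ _ mf _ _; exact: borel_measurableS (mf n).
Qed.

Lemma measurable_sup_ge (r : R) :
  measurable [set w | (r%:E <= ereal_sup (range (fun j => (Psi (f j w))%:E)))%E].
Proof.
have mE n : measurable_fun [set: T] (fun w => (Psi (f n w))%:E).
  exact: measurable_EFinS (measurable_Psi n).
have := measurable_fun_esups mE 0%N measurableT
  (emeasurable_itv (Interval (BLeft r%:E) (BInfty _ false))).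
rewrite setTI.
congr measurable; apply/seteqP; split => w; rewrite /= in_itv /= andbT /esups /=;
  suff -> : sdrop (fun n => (Psi (f n w))%:E) 0 = range (fun n => (Psi (f n w))%:E) by [];
  by apply/seteqP; split => _ [n _ <-]; exists n.
Qed.

(** The supremum may be at least [r] without any term being so; levels [r'] below
    [r] are used, chosen so that the bound loses the factor [b > 1] only. *)
Lemma sup_tail (r m : R) : 0 < m ->
    (\forall w \ae P, forall n, growth n w <= m) ->
  (P [set w | (r%:E <= ereal_sup (range (fun j => (Psi (f j w))%:E)))%E]
    <= (2 * expR (- (lam * r)) * m)%:E)%E.
Proof.
move=> m0 aem; apply: le_of_forall_gt1.
  by rewrite lee_fin mulr_ge0 ?(ltW m0) // mulr_ge0 ?expR_ge0.
move=> b b1; have b0 : 0 < b by apply: lt_trans b1.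
set r' := r - ln b / lam.
have rr' : r' < r by rewrite /r' ltrBlDr ltrDl divr_gt0 // ln_gt0.
set th := expR (lam * r') / (2 * m).
have th0 : 0 < th by rewrite divr_gt0 ?expR_gt0 // mulr_gt0.
have -> : (b%:E * (2 * expR (- (lam * r)) * m)%:E = (th^-1)%:E)%E.
  rewrite -EFinM /th invf_div -expRN /r'; congr EFin.
  have -> : - (lam * (r - ln b / lam)) = ln b + - (lam * r).
    by field; rewrite gt_eqF.
  by rewrite expRD lnK ?posrE //; ring.
have mZ n : measurable [set w | (th <= normalized n w)%R].
  rewrite -[X in measurable X]setTI.
  have mn : measurable_fun [set: T] (normalized n).
    by apply/borel_measurable_fun; exact: borel_measurableS (normalized_adapted n).
  rewrite (_ : [set w | _] = normalized n @^-1` `[th, +oo[); first exact: mn.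
  by apply/seteqP; split => w; rewrite /= in_itv /= andbT.
have mU : measurable (\bigcup_n [set w | (th <= normalized n w)%R]).
  exact: bigcup_measurable.
apply: le_trans (normalized_tail th0).
have [N [mN PN sN]] := aem.
apply: (@le_trans _ _ (P (\bigcup_n [set w | (th <= normalized n w)%R] `|` N))).
  apply: le_measure; rewrite ?inE; [exact: measurable_sup_ge|exact: measurableU|].
  move=> w /= supw; have [Nw|Nw] := pselect (N w); first by right.
  left; have gm : forall n, growth n w <= m.
    by apply: contrapT => h; apply: Nw; exact: sN.
  have : (r'%:E < ereal_sup (range (fun j => (Psi (f j w))%:E)))%E.
    by apply: lt_le_trans supw; rewrite lte_fin.
  move=> /ereal_sup_gt[_ [n _ <-]]; rewrite lte_fin => Pr'.
  exists n => //=; rewrite /normalized [leRHS]mulrC.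
  have -> : th = expR (lam * r') / 2 * m^-1 by rewrite /th invfM mulrA.
  apply: ler_pM; [by rewrite divr_ge0 ?expR_ge0|by rewrite invr_ge0 ltW| |].
    apply: le_trans (cosh_ge_expR _).
    by rewrite ler_pM2r ?invr_gt0 // ler_expR ler_pM2l // ltW.
  by rewrite lef_pV2 ?posrE // growth_gt0.
apply: (le_trans (measureU2 P mU mN)).
by rewrite -[leRHS]adde0 leeD2l // le_eqVlt; apply/orP; left; apply/eqP.
Qed.

End tail_bound.

Theorem theorem3p2 (R : realType) (X : completeNormedModType R)
  (sepX : separable X)
  (dT : measure_display) (T : measurableType dT) (P : probability T R)
  (F : nat -> set (set T)) (f : nat -> T -> X)
  (martf : martingale0 P F f)
  (lambda : R) (lambda_gt0 : 0 < lambda)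
  (expd : forall j, (1 <= j)%N ->
     (\int[P]_w (expR (lambda * `|mdiff f j w|))%:E < +oo)%E)
  (D : R) (D_gt0 : 0 < D)
  (Psi : X -> R) (smoothPsi : smooth2 D Psi)
  (c : nat -> T -> R)
  (condc : forall j, (1 <= j)%N ->
     cond_expectation P (F j.-1)
       (fun w => expR (lambda * `|mdiff f j w|) - 1 - lambda * `|mdiff f j w|)
       (c j)) :
  let e (j : nat) (w : T) : R := Num.max 1 D ^+ 2 * c j w in
  let prod_e (w : T) : \bar R :=
    limn (fun n => (\prod_(1 <= j < n.+1) (1 + e j w))%:E) in
  let sum_e (w : T) : \bar R := (\sum_(1 <= j <oo) (e j w)%:E)%E in
  forall r : R, 0 <= r ->
    (P [set w | r%:E <= ereal_sup (range (fun j => (Psi (f j w))%:E))]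
      <= (2 * expR (- (lambda * r)))%:E * 'N[P]_+oo[prod_e])%E /\
    ((2 * expR (- (lambda * r)))%:E * 'N[P]_+oo[prod_e]
      <= 2%:E * expeR ((- (lambda * r))%:E + 'N[P]_+oo[sum_e]))%E.
Proof.
move=> e prod_e sum_e r _.
set Ds := Num.max 1 D.
have Ds1 : 1 <= Ds by rewrite le_max lexx.
have smoothDs : smooth2 Ds Psi.
  by apply: smooth2_le smoothPsi; [exact: ltW|rewrite le_max lexx orbT].
have P1 : (0 < P [set: T])%E.
  by have := @probability_setT _ _ _ P => ->.
have normE (u : T -> \bar R) : ('N[P]_+oo[u])%E = ess_sup P (abse \o u).
  by rewrite unlock /Lnorm P1.
have c0 : \forall w \ae P, forall j, 0 <= c j.+1 w.
  apply: ae_foralln => j; apply: cond_expectation_ge0 (condc j.+1 isT).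
    by case: martf => -[_ + _] _ _ _ _; exact.
  by move=> w; exact: expR_rem_ge0.
have prodE w n : (forall j, 0 <= c j.+1 w) ->
    \prod_(1 <= j < n.+1) (1 + e j w) = growth Ds c n w.
  move=> cw; apply: eq_big_nat => -[//|j] _.
  by rewrite /e -/Ds max_r.
have limE w : (forall j, 0 <= c j.+1 w) ->
    prod_e w = ereal_sup (range (fun n => (growth Ds c n w)%:E)).
  move=> cw; rewrite /prod_e; under eq_fun do rewrite prodE //.
  apply/cvg_lim => //; apply: ereal_nondecreasing_cvgn.
  apply/nondecreasing_seqP => n; rewrite lee_fin growthS.
  by rewrite ler_peMr ?(ltW (growth_gt0 _ _ _ _)) // growth_factor_ge1.
have growth_le w n : (forall j, 0 <= c j.+1 w) -> ((growth Ds c n w)%:E <= prod_e w)%E.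
  by move=> cw; rewrite limE //; apply: ereal_sup_ubound; exists n.
have prod_ge1 w : (forall j, 0 <= c j.+1 w) -> (1 <= prod_e w)%E.
  by move=> cw; apply: le_trans (growth_le w 0%N cw); rewrite growth0.
split.
- set M := ('N[P]_+oo[prod_e])%E.
  have M1 : (1 <= M)%E.
    rewrite /M normE; apply: ess_sup_gee => //; apply: filterS c0 => w cw /=.
    by apply: le_trans (lee_abs _); exact: prod_ge1.
  have aeM : \forall w \ae P, forall n, ((growth Ds c n w)%:E <= M)%E.
    have := ess_sup_ge P (abse \o prod_e); rewrite -normE -/M => h.
    apply: filterS2 c0 h => w cw /= hw n; apply: le_trans hw.
    by apply: le_trans (lee_abs _); exact: growth_le.
  case: M M1 aeM => [m| |] M1 aeM //; last first.
    by rewrite gt0_muley ?leey // lte_fin mulr_gt0 // expR_gt0.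
  rewrite -EFinM; apply: (sup_tail sepX martf lambda_gt0 Ds1 smoothDs expd condc).
    by rewrite lee_fin in M1; apply: lt_le_trans M1.
  by apply: filterS aeM => w h n; rewrite -lee_fin.
- set S := ('N[P]_+oo[sum_e])%E.
  rewrite expeRD EFinM -muleA; apply: lee_wpmul2l => //.
  apply: lee_wpmul2l; first by rewrite lee_fin expR_ge0.
  rewrite normE; apply/ess_supP.
  have := ess_sup_ge P (abse \o sum_e); rewrite -normE -/S => h.
  apply: filterS2 c0 h => w cw /= sumS.
  rewrite gee0_abs; last by apply: le_trans (prod_ge1 w cw).
  rewrite limE //; apply: ge_ereal_sup => _ [n _ <-].
  have e0 j : (1 <= j)%N -> 0 <= e j w.
    by case: j => [//|j] _; rewrite mulr_ge0 ?sqr_ge0.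
  apply: (@le_trans _ _ (expeR (\sum_(1 <= j < n.+1) (e j w)%:E)%E)).
    rewrite -prodE // sumEFin /= lee_fin expR_sum.
    rewrite !big_nat; apply: ler_prod => j /andP[j1 _].
    by rewrite addr_ge0 ?e0 //= expR_ge1Dx.
  rewrite lee_expeR; apply: le_trans sumS; apply: le_trans (lee_abs _).
  by apply: nneseries_lim_ge => j j1 _; rewrite lee_fin e0.
Qed.
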